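(* Let $q$ be a positive integer, let $a>0$ and $b\ge\tfrac32$ be real numbers with $ab=\tfrac1q$. Then the Gabor system $\mathcal G(Q_2,a,b)$ is a frame for $L^2(\mathbb R)$ if and only if $|F(b)|>\tfrac1{2q}$.
   Context: For $x\in\mathbb R$, $R(x)=\lfloor x+\tfrac12\rfloor$ and $F(x)=x-R(x)\in[-\tfrac12,\tfrac12)$. The second-order B-spline is $Q_2=Q_1*Q_1$ with $Q_1=\chi_{[-1/2,1/2]}$, i.e. $Q_2(x)=\max(0,1-|x|)$. For $g\in L^2(\mathbb R)$ and $a,b>0$, the Gabor system is $\mathcal G(g,a,b)=\{g(\cdot-ak)\,e^{2\pi i m b\,\cdot}: m,k\in\mathbb Z\}$. It is a frame for $L^2(\mathbb R)$ if there exist constants $0<A\le B<\infty$ such that $A\|f\|^2\le\sum_{m,k\in\mathbb Z}|\langle f,g(\cdot-ak)e^{2\pi i m b\,\cdot}\rangle|^2\le B\|f\|^2$ for all $f\in L^2(\mathbb R)$. *)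

(* Defs.v *)
From HB Require Import structures.
From mathcomp Require Import all_boot all_order all_algebra.
From mathcomp Require Import lra.
From mathcomp Require Import complex.
From mathcomp Require Import all_classical all_reals all_analysis.
From mathcomp Require Import measurable_realfun.

Set Implicit Arguments.
Unset Strict Implicit.
Unset Printing Implicit Defensive.

Import Order.TTheory GRing.Theory Num.Theory.
Import numFieldNormedType.Exports.

Local Open Scope classical_set_scope.
Local Open Scope ring_scope.
Local Open Scope complex_scope.

Local Notation normc := ComplexField.Normc.normc.

Section NearestInteger.
Context {R : realType}.
Implicit Type x : R.

(* Half-integers are rounded up, so [frac_near] takes values in [-1/2, 1/2). *)
Definition round_near x : int := Num.floor (x + 2^-1).

Definition frac_near x : R := x - (round_near x)%:~R.

End NearestInteger.

Section BSpline.
Context {R : realType}.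
Implicit Types (f g : R -> R) (x y : R).
Local Notation mu := (@lebesgue_measure R).

Definition convolution f g x : R := \int[mu]_y (f y * g (x - y)).

Definition Q1 : R -> R := \1_(`[- 2^-1, 2^-1]).

Definition Q2 : R -> R := convolution Q1 Q1.

Lemma Q2E x : Q2 x = Num.max 0 (1 - `|x|).
Proof.
have Q1E y : Q1 (x - y) = \1_(`[x - 2^-1, x + 2^-1]) y.
  rewrite /Q1 !indicE; congr (_%:R); congr nat_of_bool.
  by apply/idP/idP; rewrite !inE/= !in_itv/= => /andP[? ?]; apply/andP; split; lra.
have -> : Q2 x = \int[mu]_y
    \1_(`[Num.max (- 2^-1) (x - 2^-1), Num.min 2^-1 (x + 2^-1)]) y.
  apply: eq_Rintegral => y _.
  rewrite Q1E /Q1 !indicE -natrM mulnb; congr (_%:R); congr nat_of_bool.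
  apply/andP/idP; rewrite !inE/= !in_itv/= ge_max le_min.
    by move=> [/andP[-> ->] /andP[-> ->]].
  by move=> /andP[/andP[-> ->] /andP[-> ->]].
rewrite /Rintegral integral_indic// setIT.
transitivity (fine (mu [set` `[Num.max (- 2^-1) (x - 2^-1),
                               Num.min 2^-1 (x + 2^-1)]])) => //.
rewrite lebesgue_measure_itv/= lte_fin.
case: (leP 0 x) => x0.
  rewrite (ger0_norm x0) max_r ?min_l; [|lra|lra].
  by case: ifPn => [|/negbTE] h; case: (leP 0 (1 - x)) => h' /=; lra.
rewrite (ltr0_norm x0) max_l ?min_r; [|lra|lra].
by case: ifPn => [|/negbTE] h; case: (leP 0 (1 - - x)) => h' /=; lra.
Qed.

End BSpline.

(* [R] carries its Borel sigma-algebra; as every Lebesgue class of L^2(R) has a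
   Borel representative, and everything below depends on functions only up to
   null sets, nothing is lost by quantifying over Borel functions. *)
Section SquareIntegrable.
Context {R : realType}.
Implicit Types f g : R -> R[i].
Local Notation mu := (@lebesgue_measure R).

Definition sq_norm2 f : \bar R :=
  (\int[mu]_x ((normc (f x) ^+ 2)%:E))%E.

Definition L2fun f : Prop :=
  [/\ measurable_fun setT (fun x => complex.Re (f x)),
      measurable_fun setT (fun x => complex.Im (f x)) &
      (sq_norm2 f < +oo)%E].

Definition cintegral f : R[i] :=
  (\int[mu]_x complex.Re (f x)) +i* (\int[mu]_x complex.Im (f x)).

Definition inner f g : R[i] := cintegral (fun x => f x * (g x)^*%C).

(* The sum is the unconditional sum of nonnegative extended reals. *)
Definition is_frame (I : choiceType) (e : I -> R -> R[i]) : Prop :=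
  exists A B : R, [/\ 0 < A, A <= B &
    forall f, L2fun f ->
      (A%:E * sq_norm2 f <=
         \esum_(i in [set: I]) (normc (inner f (e i)) ^+ 2)%:E)%E
      /\
      (\esum_(i in [set: I]) (normc (inner f (e i)) ^+ 2)%:E
         <= B%:E * sq_norm2 f)%E].

End SquareIntegrable.

Section Gabor.
Context {R : realType}.

Definition expi (t : R) : R[i] := cos t +i* sin t.

Definition gabor_system (g : R -> R[i]) (a b : R) (mk : int * int) : R -> R[i] :=
  fun x => g (x - a * mk.2%:~R) * expi (2 * pi * mk.1%:~R * b * x).

(* The window of interest is in L^2, so the integrals defining its [inner]
   products with L^2 functions all converge. *)
Lemma L2fun_Q2 : L2fun (fun x : R => (Q2 x)%:C).
Proof.
have mQ : measurable_fun setT (Q2 : R -> R).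
  rewrite (_ : Q2 = fun x => Num.max 0 (1 - `|x|)); last exact/funext/Q2E.
  apply: measurable_maxr; first exact: measurable_cst.
  by apply: measurable_funB => //; exact: measurableT_comp.
split; [exact: mQ | exact: measurable_cst |].
rewrite /sq_norm2.
apply: (@le_lt_trans _ _ (\int[lebesgue_measure]_x (\1_(`[(-1 : R), 1]) x)%:E)%E).
  apply: ge0_le_integral => //.
  - by move=> x _; rewrite lee_fin sqr_ge0.
  - apply/measurable_EFinP.
    rewrite (_ : (fun _ => _) = fun x : R => Q2 x ^+ 2); last first.
      by apply/funext => x /=; rewrite expr0n/= addr0 sqr_sqrtr ?sqr_ge0.
    exact: measurable_funX.
  - by apply/measurable_EFinP; exact: measurable_indic.
  - move=> x _; rewrite lee_fin /= expr0n/= addr0 sqr_sqrtr ?sqr_ge0// Q2E.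
    rewrite indicE mem_setE in_itv/= -ler_norml.
    have x0 := normr_ge0 x.
    case: (leP `|x| 1) => x1 /=.
      by rewrite max_r ?subr_ge0// expr_le1//; lra.
    by rewrite max_l ?expr0n//=; lra.
rewrite integral_indic// setIT.
apply: (@le_lt_trans _ _ (lebesgue_measure [set` `[(-1 : R), 1]])) => //.
by rewrite lebesgue_measure_itv/=; case: ifP => _; rewrite ltry.
Qed.

End Gabor.

(* Main.v *)
From HB Require Import structures.
Require Import Defs.
From mathcomp Require Import all_boot all_order all_algebra.
From mathcomp Require Import ring lra zify.
From mathcomp Require Import complex.
From mathcomp Require Import all_classical all_reals all_analysis.
From mathcomp Require Import measurable_realfun.
Set Implicit Arguments.
Unset Strict Implicit.
Unset Printing Implicit Defensive.
Import Order.TTheory GRing.Theory Num.Theory.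
Import numFieldNormedType.Exports.
Local Open Scope classical_set_scope.
Local Open Scope ring_scope.

(** Let T = 1/b, so that a q = T, and let tent c y = max 0 (c - |y|), so that
   Q2 = tent 1. Everything is decided by the Zak sums Z(y, t), the sum over
   n in Z of tent b (y + n) e^(i n t), whose real and imaginary parts are
   zakc and zaks. The Gabor system is a frame if and only if the q functions
   Z(y - r/q, t), r < q, have no common zero (y, t), and this in turn
   happens if and only if |F(b)| > 1/(2q).

   No common zero implies frame. The modulations are T-periodic, so the
   coefficients of f at the translation index k are Fourier coefficients on
   [0, T] of the periodization of f(x) Q2(x - a k). Writing k = q l + r
   gives a k = l T + r a; hence for fixed x and r this periodization is, as
   a function of l, the convolution of the samples f(x + i T) with the
   samples Q2(x - r a + j T), that is, the coefficient sequence of a product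
   of two polynomials (periodization_conv). The Parseval identity on [0, T]
   (bessel, parseval), followed by the one for polynomials on the circle
   (Rint_pabs2), expresses the sum of the squared coefficients through
   |C_x(e^(it))|^2, where C_x has the samples of f as coefficients,
   multiplied by b^-2 zaksum(b x, t), where zaksum(y, t) is the sum over r <
   q of |Z(y - r/q, t)|^2 (window_poly_zak, fiber_energy_bounds). As zaksum
   is continuous and only matters on the compact set [0, 1] x [0, 2 pi], it
   has a positive minimum when there is no common zero. This gives frame
   bounds for compactly supported f (box_energy_bounds), and truncation
   extends them to all of L^2 (coef_sqr_upper, coef_sqr_lower).

   A common zero (b x0, th) excludes a frame. Let f put the value e^(i n th)
   on the interval [x0 + (n - L) T, x0 + de + (n - L) T] for each n < 2 L,
   so that |f|^2 has integral 2 L de. All the convolutions of the previous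
   paragraph are O(de) on these fibers, except for the O(1) values of l near
   the two ends (conv_mid, conv_edge). Choosing first de small and then L
   large defeats any lower frame bound (box_energy_train, no_frame_of_zero).

   Zeros of Z. Let N be the integer nearest to b and F = b - N. Only the
   terms n = N and n = - N of Z meet the corner of the tent, so that Z(y, t)
   = A - |y| + i B y for |y| <= |F|, with the additional term (y - |F|) w,
   |w| = 1, for |F| <= y <= 1 - |F| (zak_affine). Together with Z(y - 1, t)
   = e^(it) Z(y, t) this shows that Z has no zero with 0 < |y| < |F|, and
   that a zero at y = 0 excludes zeros with |F| <= y <= 1 - |F|. If |F| >
   1/(2q), every coset y + Z/q has a point with |y| < |F|, and there is no
   common zero (zak_no_grid_zero). If |F| <= 1/(2q), then at t = 2 pi / N
   the function Z vanishes for |F| <= y <= 1 - |F|, an interval that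
   contains all odd multiples of 1/(2q) between 0 and 1 (zak_grid_zero). *)

(** * Zeros of the Zak sums of a tent *)

Section SymmetricSums.
Context {V : zmodType}.

Lemma sum_symE (g : int -> V) J :
  \sum_(i < (2 * J).+1) g (i%:Z - J%:Z) =
  g 0 + \sum_(1 <= n < J.+1) (g n%:Z + g (- n%:Z)).
Proof.
elim: J => [|J IH]; first by rewrite big_ord1 big_geq// !addr0.
rewrite (_ : (2 * J.+1).+1 = (2 * J).+3); last by lia.
rewrite big_ord_recr big_ord_recl /=.
rewrite [in RHS]big_nat_recr//= addrA -IH.
have E (i : nat) : (bump 0 i)%:Z - J.+1%:Z = i%:Z - J%:Z by rewrite /bump; lia.
under eq_bigr => i _ do rewrite E.
have E0 : 0%Z - J.+1%:Z = - J.+1%:Z by lia.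
have E1 : (2 * J).+2%:Z - J.+1%:Z = J.+1%:Z by lia.
by rewrite E0 E1 [LHS]addrAC [LHS]addrC; congr (_ + _); exact: addrC.
Qed.

Lemma sum_sym_opp (g : int -> V) J :
  \sum_(i < (2 * J).+1) g (- (i%:Z - J%:Z)) =
  \sum_(i < (2 * J).+1) g (i%:Z - J%:Z).
Proof.
rewrite !(sum_symE, sum_symE (fun n => g (- n))) oppr0; congr (_ + _).
by apply: eq_bigr => n _; rewrite opprK addrC.
Qed.

End SymmetricSums.

Section SplineZeros.
Context {R : realType}.
Implicit Types y th : R.

Section Fixed.
Variables (b : R).

Definition tent y : R := Num.max 0 (b - `|y|).

(** Real and imaginary parts of the Zak sum Z(y) of tent (y + n) e^(i n th)
   over n. For |y| <= 1 and b <= J, restricting it to |n| <= J loses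
   nothing. *)
Definition zakc J th y : R :=
  \sum_(i < (2 * J).+1) tent (y + (i%:Z - J%:Z)%:~R) * cos ((i%:Z - J%:Z)%:~R * th).
Definition zaks J th y : R :=
  \sum_(i < (2 * J).+1) tent (y + (i%:Z - J%:Z)%:~R) * sin ((i%:Z - J%:Z)%:~R * th).

Lemma tentN y : tent (- y) = tent y. Proof. by rewrite /tent normrN. Qed.

Lemma tent_ge0 y : 0 <= tent y. Proof. by rewrite /tent le_max lexx. Qed.

Lemma tent_eq0 y : b <= `|y| -> tent y = 0.
Proof. by move=> h; rewrite /tent max_l ?subr_le0. Qed.

Lemma zakcN J th y : zakc J th (- y) = zakc J th y.
Proof.
rewrite /zakc -(sum_sym_opp (fun n => tent (- y + n%:~R) * cos (n%:~R * th))).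
by apply: eq_bigr => i _; rewrite intrN -opprD tentN mulNr cosN.
Qed.

Lemma zaksN J th y : zaks J th (- y) = - zaks J th y.
Proof.
rewrite /zaks -(sum_sym_opp (fun n => tent (- y + n%:~R) * sin (n%:~R * th))) -sumrN.
by apply: eq_bigr => i _; rewrite intrN -opprD tentN mulNr sinN mulrN.
Qed.

Lemma zak_pairE J th y :
  zakc J th y = tent y + \sum_(1 <= n < J.+1)
     (tent (y + n%:R) + tent (y - n%:R)) * cos (n%:R * th) /\
  zaks J th y = \sum_(1 <= n < J.+1)
     (tent (y + n%:R) - tent (y - n%:R)) * sin (n%:R * th).
Proof.
rewrite /zakc (sum_symE (fun n => tent (y + n%:~R) * cos (n%:~R * th))).
rewrite /zaks (sum_symE (fun n => tent (y + n%:~R) * sin (n%:~R * th))).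
rewrite mul0r addr0 cos0 mulr1 sin0 mulr0 add0r; split.
  congr (_ + _); apply: eq_bigr => n _.
  by rewrite intrN mulNr cosN mulrDl.
by apply: eq_bigr => n _; rewrite intrN mulNr sinN mulrDl mulrN mulNr.
Qed.

(** Quasi-periodicity, Z(y - 1) = e^(i th) Z(y). The two sums run over
   windows of indices that differ by one; the two terms that do not match
   are at distance at least J >= b from the origin, where the tent vanishes. *)
Lemma zak_shift J th y : 0 <= y <= 1 -> b <= J%:R ->
  zakc J th (y - 1) = cos th * zakc J th y - sin th * zaks J th y /\
  zaks J th (y - 1) = sin th * zakc J th y + cos th * zaks J th y.
Proof.
move=> /andP[y0 y1] bJ.
have hJ0 : tent (y - 1 - J%:R) = 0.
  apply: tent_eq0; rewrite ler0_norm; last by have := ler0n R J; lra.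
  lra.
have hJ : tent (y + J%:R) = 0.
  by apply: tent_eq0; rewrite ger0_norm; have := ler0n R J; lra.
have S (g : R -> R) : \sum_(i < (2 * J).+1) tent (y - 1 + (i%:Z - J%:Z)%:~R) * g ((i%:Z - J%:Z)%:~R * th)
   = \sum_(i < (2 * J).+1) tent (y + (i%:Z - J%:Z)%:~R) * g ((i%:Z - J%:Z)%:~R * th + th).
  rewrite big_ord_recl [RHS]big_ord_recr /=.
  rewrite (_ : (2 * J)%:Z - J%:Z = J%:Z); last by lia.
  rewrite sub0r intrN hJ hJ0 !mul0r add0r addr0; apply: eq_bigr => i _.
  rewrite (_ : (bump 0 i)%:Z - J%:Z = (i%:Z - J%:Z) + 1); last by rewrite /bump /=; lia.
  rewrite intrD; congr (tent _ * g _); last by rewrite mulrDl mul1r.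
  by rewrite /=; ring.
rewrite /zakc /zaks !S !mulr_sumr -sumrB -big_split; split; apply: eq_bigr => i _.
  by rewrite cosD; ring.
by rewrite sinD /=; ring.
Qed.

Variables (N : nat) (F : R).
Hypotheses (N2 : (2 <= N)%N) (bE : b = N%:R + F) (F12 : `|F| <= 2^-1).

(** For 0 < n < N the points y + n and y - n lie on the two slopes of the
   tent, where it is affine, and for n > N they lie outside its support.
   Only n = N meets the corner of the tent, and there the fractional part F
   enters. *)
Lemma zak_pieces J th y : (N < J)%N -> `|y| <= 1 - `|F| ->
  zakc J th y = b - `|y| + 2 * (\sum_(1 <= n < N) (b - n%:R) * cos (n%:R * th))
    + (Num.max 0 (F - y) + Num.max 0 (F + y)) * cos (N%:R * th) /\
  zaks J th y = - (2 * y) * (\sum_(1 <= n < N) sin (n%:R * th))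
    + (Num.max 0 (F - y) - Num.max 0 (F + y)) * sin (N%:R * th).
Proof.
move=> NJ yF; have [-> ->] := zak_pairE J th y.
have N2' : 2 <= N%:R :> R by rewrite (ler_nat R 2).
have F0 := normr_ge0 F; have F12' := F12; have bE' := bE.
have := ler_norm F; have := ler_norm (- F); rewrite normrN => F1 F2.
move: (yF); rewrite ler_norml => /andP[y1 y2].
have lo n : (1 <= n < N)%N -> tent (y + n%:R) = b - n%:R - y /\ tent (y - n%:R) = b - n%:R + y.
  move=> /andP[n1 nN].
  have n1' : 1 <= n%:R :> R by rewrite ler1n.
  have nN' : n%:R + 1 <= N%:R :> R by rewrite natr1 ler_nat.
  rewrite /tent (ger0_norm (_ : 0 <= y + n%:R)); last lra.
  rewrite (ler0_norm (_ : y - n%:R <= 0)); last lra.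
  by rewrite !max_r; [split; ring|lra|lra].
have mid : tent (y + N%:R) = Num.max 0 (F - y) /\ tent (y - N%:R) = Num.max 0 (F + y).
  rewrite /tent (ger0_norm (_ : 0 <= y + N%:R)); last lra.
  rewrite (ler0_norm (_ : y - N%:R <= 0)); last lra.
  by split; congr Num.max; rewrite bE; ring.
have hi n : (N < n)%N -> tent (y + n%:R) = 0 /\ tent (y - n%:R) = 0.
  move=> nN.
  have nN' : N%:R + 1 <= n%:R :> R by rewrite natr1 ler_nat.
  by split; apply: tent_eq0; [rewrite ger0_norm|rewrite ler0_norm]; lra.
have y0 : tent y = b - `|y| by rewrite /tent max_r//; lra.
have split3 (g : nat -> R) : (forall n, (N < n)%N -> g n = 0) ->
    \sum_(1 <= n < J.+1) g n = \sum_(1 <= n < N) g n + g N.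
  move=> g0; rewrite (big_cat_nat (n:=N))//=; [|lia|lia].
  rewrite [X in _ + X]big_ltn; last by lia.
  rewrite (_ : \sum_(N.+1 <= i < J.+1) g i = 0) ?addr0//.
  by rewrite big_nat big1// => n /andP[h _]; exact: g0.
rewrite y0; split.
  rewrite -[RHS]addrA split3; last by move=> n /hi[-> ->]; rewrite addr0 mul0r.
  have [-> ->] := mid; congr (_ + (_ + _)).
  rewrite mulr_sumr !big_nat; apply: eq_bigr => n /lo[-> ->]; ring.
rewrite split3; last by move=> n /hi[-> ->]; rewrite subr0 mul0r.
have [-> ->] := mid; congr (_ + _).
rewrite mulr_sumr !big_nat; apply: eq_bigr => n /lo[-> ->]; ring.
Qed.

(** Z is A - |y| + i B y up to |F|, and picks up (y - |F|) w after that,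
   where w = w1 + i w2 is e^(i N th) or its conjugate according to the sign
   of F. *)
Lemma zak_affine th : exists A B w1 w2 : R, w1 ^+ 2 + w2 ^+ 2 = 1 /\
  forall J, (N < J)%N ->
  (forall y, `|y| <= `|F| -> zakc J th y = A - `|y| /\ zaks J th y = B * y) /\
  (forall y, `|F| <= y <= 1 - `|F| -> zakc J th y = A - y + (y - `|F|) * w1
      /\ zaks J th y = B * y + (y - `|F|) * w2).
Proof.
have F0 := normr_ge0 F; have F12' := F12; have bE' := bE.
set c := cos (N%:R * th); set s := sin (N%:R * th).
have cs : c ^+ 2 + s ^+ 2 = 1 by rewrite cos2Dsin2.
set S1 := \sum_(1 <= n < N) (b - n%:R) * cos (n%:R * th).
set S2 := \sum_(1 <= n < N) sin (n%:R * th).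
case: (leP 0 F) => hF.
- have FE : `|F| = F by rewrite ger0_norm.
  exists (b + 2 * S1 + 2 * F * c), (- 2 * S2 - 2 * s), c, s.
  split=> //.
  move=> J NJ; split=> y hy.
    have [|-> ->] := zak_pieces th NJ (_ : `|y| <= 1 - `|F|); first by rewrite FE in hy F12' *; lra.
    move: hy; rewrite FE ler_norml => /andP[? ?].
    rewrite -/c -/s -/S1 -/S2 !max_r; [split; ring|lra|lra].
  move: hy => /andP[h1 h2]; rewrite FE in h1 h2 *.
  have y0 : `|y| = y by rewrite ger0_norm//; lra.
  have [|-> ->] := zak_pieces th NJ (_ : `|y| <= 1 - `|F|); first by rewrite FE y0.
  rewrite -/c -/s -/S1 -/S2 y0 max_l ?max_r; [split; ring|lra|lra].
- have FE : `|F| = - F by rewrite ltr0_norm.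
  exists (b + 2 * S1), (- 2 * S2), c, (- s).
  split; first by rewrite sqrrN.
  move=> J NJ; split=> y hy.
    have [|-> ->] := zak_pieces th NJ (_ : `|y| <= 1 - `|F|); first by rewrite FE in hy F12' *; lra.
    move: hy; rewrite FE ler_norml => /andP[? ?].
    rewrite -/c -/s -/S1 -/S2 !max_l; [split; ring|lra|lra].
  move: hy => /andP[h1 h2]; rewrite FE in h1 h2 *.
  have y0 : `|y| = y by rewrite ger0_norm//; lra.
  have [|-> ->] := zak_pieces th NJ (_ : `|y| <= 1 - `|F|); first by rewrite FE y0.
  rewrite -/c -/s -/S1 -/S2 y0 max_l ?max_r; [split; ring|lra|lra].
Qed.

(** If e^(i th) = 1, all terms of Z are nonnegative and the middle one is
   positive. *)
Lemma zakc_gt0 J th y : cos th = 1 -> `|y| < b -> 0 < zakc J th y.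
Proof.
move=> c1 yb; have s0 : sin th = 0 by apply: cos1sin0; rewrite c1 normr1.
have cn n : cos (n%:R * th) = 1 /\ sin (n%:R * th) = 0.
  elim: n => [|n [IH1 IH2]]; first by rewrite mul0r cos0 sin0.
  rewrite -natr1 mulrDl mul1r cosD sinD IH1 IH2 c1 s0; split; ring.
have [-> _] := zak_pairE J th y.
apply: ltr_wpDr.
  by apply: sumr_ge0 => n _; rewrite (cn n).1 mulr1 addr_ge0// tent_ge0.
by rewrite /tent lt_max subr_gt0 yb orbT.
Qed.

(** A zero at such a y forces B = 0 and A = |y|. Put f = |F|. Then Z(-f) = A
   - f is real and negative, and the real part of e^(-i th) Z(-f) = Z(1 - f)
   reads (A - f)(1 - cos th) = (1 - 2 f)(1 - w1): a negative number would
   equal a nonnegative one. *)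
Lemma zak_neq0_center J th y : (N < J)%N -> b <= J%:R -> y != 0 -> `|y| < `|F| ->
  ~ (zakc J th y = 0 /\ zaks J th y = 0).
Proof.
move=> NJ bJ y0 yF [Pc Ps].
have N2' : 2 <= N%:R :> R by rewrite (ler_nat R 2).
have F12' := F12; have bE' := bE.
have := ler_norm (- F); rewrite normrN => F2.
have ny : 0 < `|y| by rewrite normr_gt0.
have c1 : cos th < 1.
  rewrite lt_neqAle cos_le1 andbT; apply/eqP => c1.
  by have := @zakc_gt0 J th y c1; rewrite Pc ltxx => h; apply: notF; apply/h; lra.
have [A [B [w1 [w2 [w12 /(_ J NJ) [Hin Hout]]]]]] := zak_affine th.
have [hc hs] := Hin y (ltW yF).
have B0 : B = 0 by move: hs; rewrite Ps => /esym/eqP; rewrite mulf_eq0 (negbTE y0) orbF => /eqP.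
have AE : A = `|y| by apply/eqP; rewrite -subr_eq0 -hc Pc.
have [f fE] : exists f : R, f = `|F| by exists `|F|.
rewrite -fE in F12' yF hc hs Hin Hout F2 *.
have f0 : 0 < f by lra.
have [ic is_] : zakc J th (- f) = A - f /\ zaks J th (- f) = B * - f.
  have := Hin (- f); rewrite normrN (ger0_norm (ltW f0)); exact.
have [|oc os] := Hout (1 - f); first lra.
have [|sc _] := @zak_shift J th (1 - f) _ bJ; first lra.
have E : 1 - f - 1 = - f by ring.
move: sc; rewrite E ic oc os.
have [|_ ss] := @zak_shift J th (1 - f) _ bJ; first lra.
move: ss; rewrite E is_ oc os.
rewrite B0; have cs := cos2Dsin2 th.
move: c1 cs; set z1 := cos th; set z2 := sin th => c1 cs H2 H1.
have w1le : w1 <= 1.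
  by have := sqr_ge0 (w1 - 1); have := sqr_ge0 w2; rewrite sqrrB expr1n mulr1; lra.
have : A - (1 - f) + (1 - f - f) * w1 = z1 * (A - f).
  set X := A - (1 - f) + (1 - f - f) * w1 in H1 H2 *.
  set Y := (0 * (1 - f) + (1 - f - f) * w2) in H1 H2 *.
  rewrite H1; have H2' : z1 * Y = - z2 * X by lra.
  have -> : z1 * (z1 * X - z2 * Y) = z1 ^+ 2 * X - z2 * (z1 * Y) by ring.
  by rewrite H2' -[LHS]mul1r -cs; ring.
move=> H3.
have : (A - f) * (1 - z1) = (1 - 2 * f) * (1 - w1) by lra.
have : (A - f) * (1 - z1) < 0 by rewrite nmulr_rlt0; lra.
have : 0 <= (1 - 2 * f) * (1 - w1) by rewrite mulr_ge0//; lra.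
lra.
Qed.

(** A zero at 0 means A = 0. A zero at y would then give (y - |F|) w = y - i
   B y, which is absurd since the left-hand side has modulus y - |F| and the
   right-hand side at least y. *)
Lemma zak_neq0_origin J th y : (N < J)%N -> b <= J%:R -> 0 < `|F| ->
  `|F| <= y <= 1 - `|F| -> zakc J th 0 = 0 -> zakc J th y = 0 -> zaks J th y = 0 ->
  False.
Proof.
move=> NJ bJ F0 yF P0 Pc Ps.
have [A [B [w1 [w2 [w12 /(_ J NJ) [Hin Hout]]]]]] := zak_affine th.
have [|A0 _] := Hin 0; first by rewrite normr0 ltW.
have [hc hs] := Hout y yF.
move: (yF) => /andP[y1 y2]; have f0 := F0; have [f fE] : exists f : R, f = `|F| by exists `|F|.
rewrite P0 normr0 subr0 in A0; rewrite -A0 Pc in hc; rewrite Ps in hs.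
rewrite -{}fE in y1 y2 f0 hc hs.
have e1 : (y - f) * w1 = y by lra.
have e2 : (y - f) * w2 = - (B * y) by lra.
have : (y - f) ^+ 2 = y ^+ 2 + (B * y) ^+ 2.
  by rewrite -[LHS]mulr1 -w12 mulrDr -!exprMn e1 e2 sqrrN.
have := sqr_ge0 (B * y).
have : (y - f) ^+ 2 < y ^+ 2 by rewrite ltr_sqr ?nnegrE; lra.
lra.
Qed.

(** As |F| > 1/(2q), the coset y + Z/q has a point z with |z| < |F|, and
   quasi-periodicity makes it a zero as well. By zak_neq0_center, z must be
   0. But then 1/q also belongs to the coset, and is a zero excluded by
   zak_neq0_center if 1/q < |F|, by zak_neq0_origin otherwise. *)
Lemma zak_no_grid_zero J th q y : (N < J)%N -> b <= J%:R -> (0 < q)%N ->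
  1 / (2 * q%:R) < `|F| -> 0 <= y <= 1 ->
  (forall r, (r < q)%N -> zakc J th (y - r%:R / q%:R) = 0 /\ zaks J th (y - r%:R / q%:R) = 0) ->
  False.
Proof.
move=> NJ bJ q0 qF /andP[y0 y1] Z.
have F12' := F12; have bE' := bE.
have N2' : 2 <= N%:R :> R by rewrite (ler_nat R 2).
have q0' : 0 < q%:R :> R by rewrite ltr0n.
have qF' : 1 < 2 * (q%:R * `|F|) by move: qF; rewrite ltr_pdivrMr; lra.
have q1 : (1 < q)%N.
  rewrite ltnNge; apply/negP => q1; have q1' : q%:R <= 1 :> R by rewrite lern1.
  have := normr_ge0 F; nra.
have q1' : 2 <= q%:R :> R by rewrite (ler_nat R 2).
have down (x : R) : 0 <= x <= 1 -> zakc J th x = 0 -> zaks J th x = 0 ->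
    zakc J th (x - 1) = 0 /\ zaks J th (x - 1) = 0.
  by move=> x01 c0 s0; have [-> ->] := zak_shift th x01 bJ; rewrite c0 s0 !mulr0 subr0 addr0.
have up (x : R) : 0 <= x <= 1 -> zakc J th (x - 1) = 0 -> zaks J th (x - 1) = 0 ->
    zakc J th x = 0 /\ zaks J th x = 0.
  move=> x01 c0 s0; have [h1 h2] := zak_shift th x01 bJ; rewrite c0 s0 in h1 h2.
  have cs := cos2Dsin2 th; set C := zakc J th x in h1 h2 *; set S := zaks J th x in h1 h2 *.
  have h3 : C * (cos th ^+ 2 + sin th ^+ 2) = cos th * (cos th * C - sin th * S) + sin th * (sin th * C + cos th * S) by ring.
  have h4 : S * (cos th ^+ 2 + sin th ^+ 2) = cos th * (sin th * C + cos th * S) - sin th * (cos th * C - sin th * S) by ring.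
  by move: h3 h4; rewrite cs -h1 -h2 !mulr1 !mulr0 addr0 subr0.
(* k is the integer nearest to q y, so that z = y - k/q is the point of the
   coset closest to 0; k = q is possible and leads back to r = 0 by a shift. *)
pose k : nat := Num.truncn (q%:R * y + 2^-1).
have /andP[k1 k2] : k%:R <= q%:R * y + 2^-1 < k.+1%:R.
  by apply: truncn_itv; apply: addr_ge0; [apply: mulr_ge0 => //; exact: ltW|lra].
rewrite -[k.+1%:R]natr1 in k2.
have kq : (k <= q)%N.
  rewrite -ltnS -(ltr_nat R) -[q.+1%:R]natr1; nra.
pose z := y - k%:R / q%:R.
have zE : q%:R * z = q%:R * y - k%:R by rewrite /z mulrBr mulrCA divff ?mulr1// gt_eqF.
have zF : `|z| < `|F|.
  rewrite -(ltr_pM2l q0') -{1}(ger0_norm (ltW q0')) -normrM zE ltr_norml.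
  by apply/andP; split; lra.
have [zc zs] : zakc J th z = 0 /\ zaks J th z = 0.
  move: kq; rewrite leq_eqVlt => /orP[/eqP kq|]; last exact: Z.
  rewrite /z kq divff ?gt_eqF//; apply: down; rewrite ?y0//.
    by have := (Z 0%N q0).1; rewrite mul0r subr0.
  by have := (Z 0%N q0).2; rewrite mul0r subr0.
have [z0|z0] := eqVneq z 0; last exact: (@zak_neq0_center J th z NJ bJ z0 zF).
have yE : y = k%:R / q%:R by apply/eqP; rewrite -subr_eq0 -/z z0.
have qV : q%:R * q%:R^-1 = 1 :> R by rewrite divff ?gt_eqF.
have qV0 : 0 < q%:R^-1 :> R by rewrite invr_gt0.
have [oc os] : zakc J th q%:R^-1 = 0 /\ zaks J th q%:R^-1 = 0.
  case: k yE kq {k1 k2 z zE zF zc zs z0} => [|k] yE kq.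
    (* y = 0: the neighbour 1/q is reached by a shift from r = q - 1. *)
    have e : y - q.-1%:R / q%:R = q%:R^-1 - 1.
      rewrite yE mul0r sub0r -subn1 natrB// mulrBl divff ?gt_eqF//; ring.
    have [|] := Z q.-1; first by rewrite prednK.
    by rewrite e; apply: up; nra.
  have [|] := Z k; first exact: kq.
  by rewrite (_ : y - k%:R / q%:R = q%:R^-1)// yE -[k.+1%:R]natr1 mulrDl mul1r; ring.
have V0 : 0 < `|F| by have := normr_ge0 z; lra.
have V2 : q%:R^-1 <= 2^-1 :> R by rewrite lef_pV2 ?posrE.
case: (ltP q%:R^-1 `|F|) => hq.
  apply: (@zak_neq0_center J th q%:R^-1 NJ bJ) => //; first by rewrite gt_eqF.
  by rewrite gtr0_norm.
have hq' : `|F| <= q%:R^-1 <= 1 - `|F| by rewrite hq/=; lra.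
by rewrite z0 in zc; exact: (@zak_neq0_origin J th q%:R^-1 NJ bJ V0 hq').
Qed.

(** For th = 2 pi / N one has e^(i N th) = 1, and the sines of n th, 0 < n <
   N, add up to 0; hence Z is a real constant K on [|F|, 1 - |F|]. Now Z(-
   |F|) is the conjugate of Z(|F|), that is K, but it is also e^(i th) Z(1 -
   |F|) = e^(i th) K by quasi-periodicity. As e^(i th) <> 1, K = 0. *)
Lemma zak_root_vanish J y : (N < J)%N -> b <= J%:R -> `|F| <= y <= 1 - `|F| ->
  zakc J (2 * pi / N%:R) y = 0 /\ zaks J (2 * pi / N%:R) y = 0.
Proof.
move=> NJ bJ yF; set th := 2 * pi / N%:R.
have F12' := F12; have bE' := bE; have F0 := normr_ge0 F.
have N0 : (N%:R : R) != 0 by rewrite pnatr_eq0; lia.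
have N2' : 2 <= N%:R :> R by rewrite (ler_nat R 2).
have thN : N%:R * th = pi *+ 2 by rewrite /th mulrCA mulfV// mulr1 mulr_natl.
have S0 : \sum_(1 <= n < N) sin (n%:R * th) = 0.
  set S := LHS; suff : S = - S by lra.
  rewrite /S [LHS]big_nat_rev/= -sumrN !big_nat; apply: eq_bigr => n /andP[n1 nN].
  rewrite add1n subSS natrB; last exact: ltnW.
  by rewrite mulrBl thN addrC sinD2pi sinN.
have th1 : cos th < 1.
  have th0 : 0 < th by rewrite divr_gt0 ?mulr_gt0 ?pi_gt0//; lra.
  have thpi : th <= pi by rewrite ler_pdivrMr; have := @pi_gt0 R; nra.
  rewrite -[ltRHS]cos0 ltr_cos// in_itv/= ?lexx ?pi_ge0//.
  by rewrite thpi ltW.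
set S1 := \sum_(1 <= n < N) (b - n%:R) * cos (n%:R * th).
have out (x : R) : `|F| <= x <= 1 - `|F| -> zakc J th x = b + 2 * S1 + F /\ zaks J th x = 0.
  move=> /andP[x1 x2]; have x0 : `|x| = x by rewrite ger0_norm//; lra.
  have := ler_norm F; have := ler_norm (- F); rewrite normrN => F1 F2.
  have [|-> ->] := zak_pieces th NJ (_ : `|x| <= 1 - `|F|); first by rewrite x0.
  rewrite thN S0 x0 sin2pi cos2pi -/S1 max_l ?max_r; [split; ring|lra|lra].
have [-> ->] := out y yF; split=> //.
have [|K _] := out `|F|; first by apply/andP; split; lra.
have [|K1 Z1] := out (1 - `|F|); first by apply/andP; split; lra.
have [|+ _] := @zak_shift J th (1 - `|F|) _ bJ; first lra.
rewrite (_ : 1 - `|F| - 1 = - `|F|); last by ring.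
rewrite zakcN K K1 Z1 mulr0 subr0 => h.
have /eqP : (1 - cos th) * (b + 2 * S1 + F) = 0 by lra.
rewrite mulf_eq0 => /orP[/eqP|/eqP//]; lra.
Qed.

(** The points with r > 0 are negative; the symmetry Z(- y) = conjugate of
   Z(y) brings them into [1/(2q), 1 - 1/(2q)], where zak_root_vanish
   applies. *)
Lemma zak_grid_zero J q : (N < J)%N -> b <= J%:R -> (0 < q)%N -> `|F| <= 1 / (2 * q%:R) ->
  forall r, (r < q)%N ->
  zakc J (2 * pi / N%:R) (1 / (2 * q%:R) - r%:R / q%:R) = 0 /\
  zaks J (2 * pi / N%:R) (1 / (2 * q%:R) - r%:R / q%:R) = 0.
Proof.
move=> NJ bJ q0 Fq r rq.
have q0' : (q%:R : R) != 0 by rewrite pnatr_eq0; lia.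
have qp : 0 < q%:R^-1 :> R by rewrite invr_gt0 ltr0n.
have qV : q%:R * q%:R^-1 = 1 :> R by rewrite divff.
have e : 1 / (2 * q%:R) = q%:R^-1 / 2 :> R by rewrite div1r invfM mulrC.
rewrite {}e in Fq *; set d := q%:R^-1 in qp qV Fq *.
have q1 : d <= 1 by rewrite invf_le1 ?ler1n ?ltr0n.
case: r rq => [|r] rq.
  by rewrite mul0r subr0; apply: zak_root_vanish => //; rewrite Fq/=; lra.
have r1 : 1 <= r.+1%:R :> R by rewrite ler1n.
have r2 : r.+1%:R + 1 <= q%:R :> R by rewrite natr1 ler_nat.
rewrite -[_ - _]opprK zakcN zaksN opprB.
have [|-> ->] := @zak_root_vanish J (r.+1%:R * d - d / 2) NJ bJ; last by rewrite oppr0.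
by apply/andP; split; nra.
Qed.

End Fixed.
End SplineZeros.

(** * Real square-integrable functions *)

Section SquareIntegrableReal.
Context {R : realType}.
Local Notation mu := (@lebesgue_measure R).
Implicit Types (D : set R) (u v w h : R -> R) (k C : R).

Definition sqint D u :=
  measurable_fun D u /\ mu.-integrable D (EFin \o (fun x => u x ^+ 2)).

Definition ip D u v : R := \int[mu]_(x in D) (u x * v x).

Variables (D : set R) (mD : @measurable _ (measurableTypeR R) D).

Lemma sqint_mul u v : sqint D u -> sqint D v ->
  mu.-integrable D (EFin \o (fun x => u x * v x)).
Proof.
move=> [mu_ iu] [mv iv].
apply: (le_integrable mD _ _ (integrableD mD iu iv)).
  by apply/measurable_EFinP; exact: measurable_funM.
move=> x Dx /=; rewrite lee_fin normrM [leRHS]ger0_norm ?addr_ge0 ?sqr_ge0//.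
rewrite -(real_normK (num_real (u x))) -(real_normK (num_real (v x))).
have := sqr_ge0 (`|u x| - `|v x|); rewrite sqrrB.
have := mulr_ge0 (normr_ge0 (u x)) (normr_ge0 (v x)); lra.
Qed.

Lemma sqintD u v : sqint D u -> sqint D v -> sqint D (fun x => u x + v x).
Proof.
move=> su sv; have [[mu_ iu] [mv iv]] := (su, sv).
split; first exact: measurable_funD.
have := integrableD mD (integrableD mD iu iv)
  (integrableD mD (sqint_mul su sv) (sqint_mul su sv)).
apply: eq_integrable => // x _ /=.
by rewrite -!EFinD; congr EFin; ring.
Qed.

Lemma sqintZ k u : sqint D u -> sqint D (fun x => k * u x).
Proof.
move=> [mu_ iu]; split; first exact: measurable_funM.
have := integrableZl mD (k ^+ 2) iu.
by apply: eq_integrable => // x _ /=; rewrite -EFinM exprMn.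
Qed.

Lemma sqintB u v : sqint D u -> sqint D v -> sqint D (fun x => u x - v x).
Proof.
move=> su sv; have := sqintD su (sqintZ (-1) sv).
by congr (sqint _ _); apply/funext => x; rewrite mulN1r.
Qed.

Lemma sqint0 : sqint D (fun=> 0).
Proof.
split; first exact: measurable_cst.
by rewrite (_ : _ \o _ = cst 0%E); [exact: integrable0 |
  apply/funext => x /=; rewrite expr0n].
Qed.

Lemma sqint_sum (I : Type) (s : seq I) (P : pred I) (f : I -> R -> R) :
  (forall i, sqint D (f i)) -> sqint D (fun x => \sum_(i <- s | P i) f i x).
Proof.
move=> sf; elim: s => [|i s IH].
  by under eq_fun do rewrite big_nil; exact: sqint0.
under eq_fun do rewrite big_cons; case: (P i) => //.
exact: sqintD.
Qed.

Lemma sqintM_bounded u h C : sqint D u -> measurable_fun D h ->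
  (forall x, D x -> `|h x| <= C) -> sqint D (fun x => h x * u x).
Proof.
move=> [mu_ iu] mh hC; split; first exact: measurable_funM.
apply: (le_integrable mD _ _ (integrableZl mD (C ^+ 2) iu)).
  by apply/measurable_EFinP; apply: measurable_funX; exact: measurable_funM.
move=> x Dx /=; rewrite lee_fin ger0_norm ?sqr_ge0// ger0_norm; last first.
  by rewrite mulr_ge0 ?sqr_ge0.
rewrite exprMn ler_wpM2r ?sqr_ge0// -real_normK ?num_real//.
have := hC x Dx; have := normr_ge0 (h x) => h0 h1.
by rewrite ler_sqr ?nnegrE// (le_trans h0).
Qed.

Lemma sqint_bounded u C : (mu D < +oo)%E -> measurable_fun D u ->
  (forall x, D x -> `|u x| <= C) -> sqint D u.
Proof.
move=> Dfin mu_ uC; split=> //.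
apply: measurable_bounded_integrable => //; first exact: measurable_funX.
exists (C ^+ 2); split; first exact: num_real.
move=> M CM x Dx /=; rewrite normrX (le_trans _ (ltW CM))//.
by rewrite ler_sqr ?nnegrE ?(le_trans _ (uC x Dx)) ?uC.
Qed.

Lemma ipC u v : ip D u v = ip D v u.
Proof. by apply: eq_Rintegral => x _; rewrite mulrC. Qed.

Lemma ipDl u v w : sqint D u -> sqint D v -> sqint D w ->
  ip D (fun x => u x + v x) w = ip D u w + ip D v w.
Proof.
move=> su sv sw; rewrite /ip -RintegralD//; do ?exact: sqint_mul.
by apply: eq_Rintegral => x _; rewrite mulrDl.
Qed.

Lemma ipZl k u w : sqint D u -> sqint D w ->
  ip D (fun x => k * u x) w = k * ip D u w.
Proof.
move=> su sw; rewrite /ip -RintegralZl//; do ?exact: sqint_mul.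
by apply: eq_Rintegral => x _; rewrite mulrA.
Qed.

Lemma ipBl u v w : sqint D u -> sqint D v -> sqint D w ->
  ip D (fun x => u x - v x) w = ip D u w - ip D v w.
Proof.
move=> su sv sw; rewrite /ip -RintegralB//; do ?exact: sqint_mul.
by apply: eq_Rintegral => x _; rewrite mulrBl.
Qed.

Lemma ip0l w : ip D (fun=> 0) w = 0.
Proof. by rewrite /ip; under eq_Rintegral do rewrite mul0r; rewrite Rintegral_cst// mul0r. Qed.

Lemma ip_suml (I : Type) (s : seq I) (P : pred I) (f : I -> R -> R) w :
  (forall i, sqint D (f i)) -> sqint D w ->
  ip D (fun x => \sum_(i <- s | P i) f i x) w = \sum_(i <- s | P i) ip D (f i) w.
Proof.
move=> sf sw; elim: s => [|i s IH].
  by rewrite big_nil; under eq_fun do rewrite big_nil; exact: ip0l.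
rewrite big_cons; under eq_fun do rewrite big_cons; case: (P i) => //.
by rewrite ipDl ?IH//; exact: sqint_sum.
Qed.

Lemma ip_ge0 u : 0 <= ip D u u.
Proof. by apply: Rintegral_ge0 => x _; rewrite -expr2 sqr_ge0. Qed.

Lemma ip_sqrB u v : sqint D u -> sqint D v ->
  ip D (fun x => u x - v x) (fun x => u x - v x) =
  ip D u u - 2 * ip D u v + ip D v v.
Proof.
move=> su sv; have suv := sqintB su sv.
rewrite ipBl// !(ipC _ (fun x => u x - v x)) !ipBl// (ipC v u); ring.
Qed.

Lemma ip_sqrD_le u v : sqint D u -> sqint D v ->
  ip D (fun x => u x + v x) (fun x => u x + v x) <=
  2 * ip D u u + 2 * ip D v v.
Proof.
move=> su sv; have := ip_ge0 (fun x => u x - v x); rewrite ip_sqrB//.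
have suv := sqintD su sv.
rewrite ipDl// !(ipC _ (fun x => u x + v x)) !ipDl// (ipC v u); lra.
Qed.

(** Dominated convergence in mean square. The null set leaves room for
   sequences that converge only away from finitely many points. *)
Lemma ip_dominated_cvg (N : set R) (u_ : nat -> R -> R) u g :
  @measurable _ (measurableTypeR R) N -> mu N = 0%E ->
  (forall n, sqint D (u_ n)) -> sqint D u -> sqint D g ->
  (forall x, D x -> ~ N x -> u_ n x @[n --> \oo] --> u x) ->
  (forall n x, D x -> `|u x - u_ n x| <= g x) ->
  forall e : R, 0 < e -> exists n0, forall n, (n0 <= n)%N ->
    ip D (fun x => u x - u_ n x) (fun x => u x - u_ n x) <= e.
Proof.
move=> mN N0 sun su sg cvgu dom e e0.
pose f_ n x := ((u x - u_ n x) ^+ 2)%:E.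
have sd n := sqintB su (sun n).
have [| | | | |_ _] := @dominated_convergence _ (measurableTypeR R) R mu D mD f_ (cst 0%E)
    (fun x => (g x ^+ 2)%:E).
- by move=> n; exact: measurable_int (sd n).2.
- exact: measurable_cst.
- exists N; split=> // x /= /not_implyP[Dx]; apply: contra_notP => /(cvgu x Dx) h.
  apply: cvg_EFin; first by near=> n.
  rewrite (_ : fine \o _ = fun n => (u x - u_ n x) ^+ 2)//.
  rewrite -[X in _ --> X](_ : (u x - u x) ^+ 2 = 0); last by rewrite subrr expr0n.
  by apply: cvgM; apply: cvgB => //; exact: cvg_cst.
- exact: sg.2.
- apply: aeW => x n Dx; rewrite lee_fin ger0_norm ?sqr_ge0//.
  by rewrite -[leLHS]real_normK ?num_real// ler_sqr ?nnegrE ?dom// (le_trans _ (dom n x Dx)).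
rewrite integral0 => /fine_cvg /cvgrPdist_le /(_ e e0) [n0 _ H].
exists n0 => n /H /=; rewrite sub0r normrN => h.
by apply: le_trans h; apply: ler_norm.
Unshelve. all: by end_near. Qed.

End SquareIntegrableReal.
Arguments ipC {R D} u v.
Arguments ip_ge0 {R D} u.

(** * Fourier sums on a period and Bessel's inequality *)

Section Fourier.
Context {R : realType}.
Variables (T w : R).
Hypotheses (T0 : 0 < T) (wT : w * T = 2 * pi).
Local Notation mu := (@lebesgue_measure R).
Let I : set R := `[0, T].
Implicit Types u v : R -> R.
Local Notation "'<<' u , v '>>'" := (ip I u v).

Definition mode_cos (n : int) (x : R) : R := cos (n%:~R * (w * x)).
Definition mode_sin (n : int) (x : R) : R := sin (n%:~R * (w * x)).

Lemma measurable_I : @measurable _ (measurableTypeR R) I. Proof. exact: measurable_itv. Qed.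
Hint Resolve measurable_I : core.

Lemma measure_I : mu I = T%:E.
Proof. by rewrite /I lebesgue_measure_itv/= lte_fin T0 sube0. Qed.

Lemma measure_I_fin : (mu I < +oo)%E. Proof. by rewrite measure_I ltry. Qed.

Lemma continuous_mode_cos n : continuous (mode_cos n).
Proof.
move=> x; apply: (@continuous_comp _ _ _ (fun x => n%:~R * (w * x)) cos).
  by apply: cvgZr; apply: cvgZr; exact: cvg_id.
exact: continuous_cos.
Qed.

Lemma continuous_mode_sin n : continuous (mode_sin n).
Proof.
move=> x; apply: (@continuous_comp _ _ _ (fun x => n%:~R * (w * x)) sin).
  by apply: cvgZr; apply: cvgZr; exact: cvg_id.
exact: continuous_sin.
Qed.

Lemma measurable_mode_cos n D : measurable_fun D (mode_cos n).
Proof. apply: measurable_funTS; apply: continuous_measurable_fun; exact: continuous_mode_cos. Qed.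

Lemma measurable_mode_sin n D : measurable_fun D (mode_sin n).
Proof. apply: measurable_funTS; apply: continuous_measurable_fun; exact: continuous_mode_sin. Qed.

Lemma sqint_mode_cos n : sqint I (mode_cos n).
Proof.
apply: (@sqint_bounded _ _ measurable_I _ 1); [exact: measure_I_fin|exact: measurable_mode_cos|].
by move=> x _; exact: cos_max.
Qed.

Lemma sqint_mode_sin n : sqint I (mode_sin n).
Proof.
apply: (@sqint_bounded _ _ measurable_I _ 1); [exact: measure_I_fin|exact: measurable_mode_sin|].
by move=> x _; exact: sin_max.
Qed.

Lemma mode_cos0 : mode_cos 0 = fun=> 1.
Proof. by apply/funext => x; rewrite /mode_cos mul0r cos0. Qed.
Lemma mode_sin0 : mode_sin 0 = fun=> 0.
Proof. by apply/funext => x; rewrite /mode_sin mul0r sin0. Qed.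
Lemma mode_cosN n : mode_cos (- n) = mode_cos n.
Proof. by apply/funext => x; rewrite /mode_cos intrN mulNr cosN. Qed.
Lemma mode_sinN n x : mode_sin (- n) x = - mode_sin n x.
Proof. by rewrite /mode_sin intrN mulNr sinN. Qed.

Lemma cos_period (n : int) : cos (n%:~R * (2 * pi)) = 1 :> R /\ sin (n%:~R * (2 * pi)) = 0 :> R.
Proof.
have H (k : nat) : cos (k%:R * (2 * pi)) = 1 :> R /\ sin (k%:R * (2 * pi)) = 0 :> R.
  elim: k => [|k [IH1 IH2]]; first by rewrite mul0r cos0 sin0.
  by rewrite -natr1 mulrDl mul1r (mulr_natl pi 2) cosD2pi sinD2pi -(mulr_natl pi 2).
case: n => k; first exact: H.
by rewrite NegzE intrN mulNr cosN sinN; have [-> ->] := H k.+1; rewrite oppr0.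
Qed.

Lemma Rint_mode_cos n : \int[mu]_(x in I) mode_cos n x = if n == 0 then T else 0.
Proof.
case: ifPn => [/eqP ->|n0].
  rewrite mode_cos0 [LHS]Rintegral_cst// mul1r.
  by transitivity (fine T%:E) => //; congr fine; exact: measure_I.
have w0 : w != 0.
  apply/eqP => w0; move: wT; rewrite w0 mul0r => /esym/eqP.
  by rewrite mulf_eq0 pnatr_eq0/= gt_eqF// pi_gt0.
have nw : n%:~R * w != 0 by rewrite mulf_neq0 ?intr_eq0.
pose F : R -> R := (n%:~R * w)^-1 \*: (sin \o (fun x : R => n%:~R * (w * x))).
have dF (x : R) : is_derive x (1 : R) F (mode_cos n x).
  have H : is_derive x (1 : R) (fun x : R => n%:~R * (w * x)) (n%:~R * w).
    by apply: is_derive_eq; rewrite /GRing.scale/= mulr1.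
  have := is_deriveZ (n%:~R * w)^-1 (@is_derive1_comp _ sin (fun x : R => n%:~R * (w * x)) x _ _ (is_derive_sin (n%:~R * (w * x))) H).
  suff -> : mode_cos n x = (n%:~R * w)^-1 *: (cos (n%:~R * (w * x)) * (n%:~R * w)) by [].
  by rewrite /GRing.scale/= mulrCA mulVf// mulr1.
rewrite /Rintegral (@continuous_FTC2 _ _ F)//.
- by rewrite /F /= /GRing.scale/= wT (cos_period n).2 !mulr0 sin0 !mulr0 subrr.
- exact/continuous_subspaceT/continuous_mode_cos.
- split.
  + by move=> x _; exact: ex_derive.
  + apply: cvg_at_right_filter; apply: differentiable_continuous; apply/derivable1_diffP; exact: ex_derive.
  + apply: cvg_at_left_filter; apply: differentiable_continuous; apply/derivable1_diffP; exact: ex_derive.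
- by move=> x _; rewrite derive1E; exact: derive_val.
Qed.

Lemma Rint_mode_sin n : \int[mu]_(x in I) mode_sin n x = 0.
Proof.
have [->|n0] := eqVneq n 0; first by rewrite mode_sin0 [LHS]Rintegral_cst// mul0r.
have w0 : w != 0.
  apply/eqP => w0; move: wT; rewrite w0 mul0r => /esym/eqP.
  by rewrite mulf_eq0 pnatr_eq0/= gt_eqF// pi_gt0.
have nw : n%:~R * w != 0 by rewrite mulf_neq0 ?intr_eq0.
pose F : R -> R := (- (n%:~R * w)^-1) \*: (cos \o (fun x : R => n%:~R * (w * x))).
have dF (x : R) : is_derive x (1 : R) F (mode_sin n x).
  have H : is_derive x (1 : R) (fun x : R => n%:~R * (w * x)) (n%:~R * w).
    by apply: is_derive_eq; rewrite /GRing.scale/= mulr1.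
  have := is_deriveZ (- (n%:~R * w)^-1) (@is_derive1_comp _ cos (fun x : R => n%:~R * (w * x)) x _ _ (is_derive_cos (n%:~R * (w * x))) H).
  suff -> : mode_sin n x = - (n%:~R * w)^-1 *: (- sin (n%:~R * (w * x)) * (n%:~R * w)) by [].
  by rewrite /GRing.scale/= mulNr [X in - (_ * X)]mulNr mulrN opprK mulrCA mulVf// mulr1.
rewrite /Rintegral (@continuous_FTC2 _ _ F)//.
- by rewrite /F /= /GRing.scale/= wT (cos_period n).1 !mulr0 cos0 subrr.
- exact/continuous_subspaceT/continuous_mode_sin.
- split.
  + by move=> x _; exact: ex_derive.
  + apply: cvg_at_right_filter; apply: differentiable_continuous; apply/derivable1_diffP; exact: ex_derive.
  + apply: cvg_at_left_filter; apply: differentiable_continuous; apply/derivable1_diffP; exact: ex_derive.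
- by move=> x _; rewrite derive1E; exact: derive_val.
Qed.

Lemma mode_cos_mode_cos m n x : mode_cos m x * mode_cos n x = 2^-1 * mode_cos (m - n) x + 2^-1 * mode_cos (m + n) x.
Proof. by rewrite /mode_cos intrB intrD mulrBl mulrDl cosB cosD; field. Qed.
Lemma mode_sin_mode_sin m n x : mode_sin m x * mode_sin n x = 2^-1 * mode_cos (m - n) x - 2^-1 * mode_cos (m + n) x.
Proof. by rewrite /mode_cos /mode_sin intrB intrD mulrBl mulrDl cosB cosD; field. Qed.
Lemma mode_sin_mode_cos m n x : mode_sin m x * mode_cos n x = 2^-1 * mode_sin (m + n) x + 2^-1 * mode_sin (m - n) x.
Proof. by rewrite /mode_cos /mode_sin intrB intrD mulrBl mulrDl sinB sinD; field. Qed.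

Lemma integrable_mode_cos n k : mu.-integrable I (EFin \o (fun x => k * mode_cos n x)).
Proof.
have := sqint_mul measurable_I (sqintZ measurable_I k (sqint_mode_cos n)) (sqint_mode_cos 0).
by rewrite mode_cos0; under eq_fun do rewrite mulr1.
Qed.
Lemma integrable_mode_sin n k : mu.-integrable I (EFin \o (fun x => k * mode_sin n x)).
Proof.
have := sqint_mul measurable_I (sqintZ measurable_I k (sqint_mode_sin n)) (sqint_mode_cos 0).
by rewrite mode_cos0; under eq_fun do rewrite mulr1.
Qed.

Lemma RintZ_mode_cos n k : \int[mu]_(x in I) (k * mode_cos n x) = k * if n == 0 then T else 0.
Proof.
rewrite RintegralZl ?Rint_mode_cos//.
by have := integrable_mode_cos n 1; under eq_fun do rewrite mul1r.
Qed.
Lemma RintZ_mode_sin n k : \int[mu]_(x in I) (k * mode_sin n x) = 0.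
Proof.
rewrite RintegralZl ?Rint_mode_sin ?mulr0//.
by have := integrable_mode_sin n 1; under eq_fun do rewrite mul1r.
Qed.

Lemma ip_cc m n : << mode_cos m, mode_cos n >> = T / 2 * ((m == n)%:R + (m == - n)%:R).
Proof.
rewrite /ip; under eq_Rintegral do rewrite mode_cos_mode_cos.
rewrite RintegralD//; [|exact: integrable_mode_cos..].
rewrite !RintZ_mode_cos subr_eq0 addr_eq0.
by case: eqP; case: eqP => _ _ /=; ring.
Qed.

Lemma ip_ss m n : << mode_sin m, mode_sin n >> = T / 2 * ((m == n)%:R - (m == - n)%:R).
Proof.
rewrite /ip; under eq_Rintegral do rewrite mode_sin_mode_sin.
rewrite RintegralB//; [|exact: integrable_mode_cos..].
rewrite !RintZ_mode_cos subr_eq0 addr_eq0.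
by case: eqP; case: eqP => _ _ /=; ring.
Qed.

Lemma ip_sc m n : << mode_sin m, mode_cos n >> = 0.
Proof.
rewrite /ip; under eq_Rintegral do rewrite mode_sin_mode_cos.
by rewrite RintegralD//; [rewrite !RintZ_mode_sin addr0|exact: integrable_mode_sin..].
Qed.

(** Each nonzero frequency is counted twice, as m and - m; this is why the
   normalization is 1/T and not 2/T. *)
Definition fourier_sum M u x :=
  T^-1 * \sum_(i < (2 * M).+1) (<< u, mode_cos (i%:Z - M%:Z) >> * mode_cos (i%:Z - M%:Z) x
    + << u, mode_sin (i%:Z - M%:Z) >> * mode_sin (i%:Z - M%:Z) x).

Lemma sqint_fourier_sum M u : sqint I (fourier_sum M u).
Proof.
apply: sqintZ => //; apply: (sqint_sum measurable_I) => i.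
by apply: (sqintD measurable_I); apply: (sqintZ measurable_I); [exact: sqint_mode_cos|exact: sqint_mode_sin].
Qed.

Lemma sum_delta M (F : int -> R) n : (`|n| <= M)%N ->
  \sum_(i < (2 * M).+1) F (i%:Z - M%:Z) * (i%:Z - M%:Z == n)%:R = F n.
Proof.
move=> nM; have kM : (`|(n + M%:Z)%R| < (2 * M).+1)%N by lia.
rewrite (bigD1 (Ordinal kM))//= big1 ?addr0.
  by rewrite (_ : `|(n + M%:Z)%R|%N%:Z - M%:Z = n) ?eqxx ?mulr1//; lia.
move=> i /eqP ik; case: eqP => [e|]; rewrite ?mulr0//.
by exfalso; apply: ik; apply/val_inj => /=; lia.
Qed.

Lemma fourier_sum_mode_cos M u n : sqint I u -> (`|n| <= M)%N ->
  << fourier_sum M u, mode_cos n >> = << u, mode_cos n >>.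
Proof.
move=> su nM; pose A m := << u, mode_cos m >>; pose B m := << u, mode_sin m >>.
have sAB m : sqint I (fun x => A m * mode_cos m x + B m * mode_sin m x).
  by apply: (sqintD measurable_I); apply: (sqintZ measurable_I); [exact: sqint_mode_cos|exact: sqint_mode_sin].
rewrite ipZl//; [|by apply: (sqint_sum measurable_I) => i; exact: sAB|exact: sqint_mode_cos].
rewrite ip_suml//; [|by move=> i; exact: sAB|exact: sqint_mode_cos].
rewrite (eq_bigr (fun i : 'I_(2 * M).+1 =>
   T / 2 * (A (i%:Z - M%:Z) * (i%:Z - M%:Z == n)%:R +
            A (i%:Z - M%:Z) * (i%:Z - M%:Z == - n)%:R))); last first.
  move=> i _; rewrite ipDl//; [|exact/sqintZ/sqint_mode_cos|exact/sqintZ/sqint_mode_sin|exact: sqint_mode_cos].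
  rewrite !ipZl//; [|exact: sqint_mode_sin|exact: sqint_mode_cos|exact: sqint_mode_cos|exact: sqint_mode_cos].
  by rewrite ip_cc ip_sc mulr0 addr0 -/(A _); ring.
rewrite -mulr_sumr big_split/= !sum_delta ?abszN// /A mode_cosN.
by field; rewrite gt_eqF.
Qed.

Lemma fourier_sum_mode_sin M u n : sqint I u -> (`|n| <= M)%N ->
  << fourier_sum M u, mode_sin n >> = << u, mode_sin n >>.
Proof.
move=> su nM; pose A m := << u, mode_cos m >>; pose B m := << u, mode_sin m >>.
have sAB m : sqint I (fun x => A m * mode_cos m x + B m * mode_sin m x).
  by apply: (sqintD measurable_I); apply: (sqintZ measurable_I); [exact: sqint_mode_cos|exact: sqint_mode_sin].
have BN m : B (- m) = - B m.
  rewrite /B (_ : mode_sin (- m) = fun x => -1 * mode_sin m x); last first.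
    by apply/funext => x; rewrite mode_sinN mulN1r.
  by rewrite ipC ipZl ?mulN1r// 1?ipC//; exact: sqint_mode_sin.
rewrite ipZl//; [|by apply: (sqint_sum measurable_I) => i; exact: sAB|exact: sqint_mode_sin].
rewrite ip_suml//; [|by move=> i; exact: sAB|exact: sqint_mode_sin].
rewrite (eq_bigr (fun i : 'I_(2 * M).+1 =>
   T / 2 * (B (i%:Z - M%:Z) * (i%:Z - M%:Z == n)%:R -
            B (i%:Z - M%:Z) * (i%:Z - M%:Z == - n)%:R))); last first.
  move=> i _; rewrite ipDl//; [|exact/sqintZ/sqint_mode_cos|exact/sqintZ/sqint_mode_sin|exact: sqint_mode_sin].
  rewrite !ipZl//; [|exact: sqint_mode_sin|exact: sqint_mode_sin|exact: sqint_mode_cos|exact: sqint_mode_sin].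
  by rewrite (ipC (mode_cos _) _) ip_ss ip_sc mulr0 add0r -/(B _); ring.
rewrite -mulr_sumr sumrB !sum_delta ?abszN// BN /B.
by field; rewrite gt_eqF.
Qed.

Definition energy M u := \sum_(i < (2 * M).+1)
  (<< u, mode_cos (i%:Z - M%:Z) >> ^+ 2 + << u, mode_sin (i%:Z - M%:Z) >> ^+ 2).

Lemma ip_fourier_sum_l M u v : sqint I v ->
  << fourier_sum M u, v >> = T^-1 * \sum_(i < (2 * M).+1)
    (<< u, mode_cos (i%:Z - M%:Z) >> * << v, mode_cos (i%:Z - M%:Z) >>
     + << u, mode_sin (i%:Z - M%:Z) >> * << v, mode_sin (i%:Z - M%:Z) >>).
Proof.
move=> sv.
have sAB m : sqint I (fun x => << u, mode_cos m >> * mode_cos m x + << u, mode_sin m >> * mode_sin m x).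
  by apply: (sqintD measurable_I); apply: (sqintZ measurable_I); [exact: sqint_mode_cos|exact: sqint_mode_sin].
rewrite ipZl//; last exact: (sqint_sum measurable_I).
rewrite ip_suml//; congr (_ * _); apply: eq_bigr => i _.
rewrite ipDl//; [|exact/sqintZ/sqint_mode_cos|exact/sqintZ/sqint_mode_sin].
rewrite !ipZl//; [|exact: sqint_mode_sin|exact: sqint_mode_cos].
by rewrite (ipC (mode_cos _) _) (ipC (mode_sin _) _).
Qed.

Lemma fourier_sum_dist M u : sqint I u ->
  << (fun x => u x - fourier_sum M u x), (fun x => u x - fourier_sum M u x) >> =
  << u, u >> - T^-1 * energy M u.
Proof.
move=> su; have sS := sqint_fourier_sum M u.
rewrite ip_sqrB// (ipC u _) !ip_fourier_sum_l//.
rewrite (eq_bigr (fun i : 'I_(2 * M).+1 => << u, mode_cos (i%:Z - M%:Z) >> ^+ 2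
      + << u, mode_sin (i%:Z - M%:Z) >> ^+ 2)); last by move=> i _; rewrite -!expr2.
rewrite -/(energy M u) (eq_bigr (fun i : 'I_(2 * M).+1 => << u, mode_cos (i%:Z - M%:Z) >> ^+ 2
      + << u, mode_sin (i%:Z - M%:Z) >> ^+ 2)).
  by rewrite -/(energy M u); ring.
move=> i _; rewrite fourier_sum_mode_cos ?fourier_sum_mode_sin//; have := ltn_ord i; lia.
Qed.

(** The energy is, up to the factor T, what the Fourier sum of u takes off
   the squared norm of u (fourier_sum_dist). *)
Lemma bessel M u : sqint I u -> energy M u <= T * << u, u >>.
Proof.
move=> su; have := @ip_ge0 _ I (fun x => u x - fourier_sum M u x).
by rewrite fourier_sum_dist// subr_ge0 ler_pdivrMl.
Qed.

(** An inductive span: closure under products and powers is then proved by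
   structural induction, with no manipulation of coefficient families. *)
Inductive trigpoly : (R -> R) -> Prop :=
| trigpoly_cos c n : trigpoly (fun x => c * mode_cos n x)
| trigpoly_sin c n : trigpoly (fun x => c * mode_sin n x)
| trigpoly_add p q : trigpoly p -> trigpoly q -> trigpoly (fun x => p x + q x).

Lemma trigpoly_cst c : trigpoly (fun=> c).
Proof.
rewrite (_ : (fun=> c) = (fun x => c * mode_cos 0 x)); first exact: trigpoly_cos.
by apply/funext => x; rewrite mode_cos0 mulr1.
Qed.

Lemma trigpoly_mul p q : trigpoly p -> trigpoly q -> trigpoly (fun x => p x * q x).
Proof.
have addE (f g h : R -> R) : trigpoly f -> trigpoly g -> (forall x, h x = f x + g x) -> trigpoly h.
  by move=> tf tg e; rewrite (_ : h = fun x => f x + g x); [exact: trigpoly_add|exact/funext].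
move=> tp; elim: tp q => {p} [c n|c n|p1 p2 _ IH1 _ IH2] q tq.
- elim: tq => {q} [d m|d m|q1 q2 _ IH1 _ IH2].
  + apply: (addE _ _ _ (trigpoly_cos (c * d / 2) (n - m)) (trigpoly_cos (c * d / 2) (n + m))) => x.
    by rewrite mulrACA mode_cos_mode_cos; ring.
  + apply: (addE _ _ _ (trigpoly_sin (c * d / 2) (m + n)) (trigpoly_sin (c * d / 2) (m - n))) => x.
    by rewrite mulrACA (mulrC (mode_cos _ _)) mode_sin_mode_cos; ring.
  + by apply: (addE _ _ _ IH1 IH2) => x; rewrite mulrDr.
- elim: tq => {q} [d m|d m|q1 q2 _ IH1 _ IH2].
  + apply: (addE _ _ _ (trigpoly_sin (c * d / 2) (n + m)) (trigpoly_sin (c * d / 2) (n - m))) => x.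
    by rewrite mulrACA mode_sin_mode_cos; ring.
  + apply: (addE _ _ _ (trigpoly_cos (c * d / 2) (n - m)) (trigpoly_cos (- (c * d / 2)) (n + m))) => x.
    by rewrite mulrACA mode_sin_mode_sin; ring.
  + by apply: (addE _ _ _ IH1 IH2) => x; rewrite mulrDr.
- by apply: (addE _ _ _ (IH1 _ tq) (IH2 _ tq)) => x; rewrite mulrDl.
Qed.

Lemma trigpoly_exp p n : trigpoly p -> trigpoly (fun x => p x ^+ n).
Proof.
move=> tp; elim: n => [|n IH].
  by under eq_fun do rewrite expr0; exact: trigpoly_cst.
by under eq_fun do rewrite exprS; exact: trigpoly_mul.
Qed.

Lemma sqint_trigpoly p : trigpoly p -> sqint I p.
Proof.
elim=> [c n|c n|p1 p2 _ IH1 _ IH2].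
- exact/sqintZ/sqint_mode_cos.
- exact/sqintZ/sqint_mode_sin.
- exact: sqintD.
Qed.

(** The difference between u and its Fourier sum is orthogonal to all
   frequencies up to M, hence to p once M exceeds the degree of p. *)
Lemma trigpoly_orth p : trigpoly p -> exists M0, forall M u, (M0 <= M)%N -> sqint I u ->
  << (fun x => u x - fourier_sum M u x), p >> = 0.
Proof.
elim=> [c n|c n|p1 p2 t1 [M1 IH1] t2 [M2 IH2]].
- exists `|n|%N => M u nM su; have sS := sqint_fourier_sum M u.
  rewrite ipC ipZl//; [|exact: sqint_mode_cos|exact: sqintB].
  by rewrite ipC ipBl// ?fourier_sum_mode_cos// ?subrr ?mulr0//; exact: sqint_mode_cos.
- exists `|n|%N => M u nM su; have sS := sqint_fourier_sum M u.
  rewrite ipC ipZl//; [|exact: sqint_mode_sin|exact: sqintB].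
  by rewrite ipC ipBl// ?fourier_sum_mode_sin// ?subrr ?mulr0//; exact: sqint_mode_sin.
- exists (maxn M1 M2) => M u; rewrite geq_max => /andP[h1 h2] su.
  have sS := sqint_fourier_sum M u.
  rewrite ipC ipDl//; [|exact: sqint_trigpoly|exact: sqint_trigpoly|exact: sqintB].
  by rewrite (ipC p1 _) (ipC p2 _) IH1// IH2// addr0.
Qed.

(** For M beyond the degree of p, the Fourier sum is the best approximation
   of u and is at least as close to u as p. *)
Lemma energy_approx p u : trigpoly p -> sqint I u -> exists M0, forall M, (M0 <= M)%N ->
  T * << u, u >> - T * << (fun x => u x - p x), (fun x => u x - p x) >> <= energy M u.
Proof.
move=> tp su; have [M0 H] := trigpoly_orth tp; exists M0 => M MM.
have sS := sqint_fourier_sum M u; have sp := sqint_trigpoly tp.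
have hp := H M u MM su.
have hS : << (fun x => u x - fourier_sum M u x), fourier_sum M u >> = 0.
  rewrite ipBl// (ipC u _) !ip_fourier_sum_l//; apply/eqP; rewrite subr_eq0; apply/eqP.
  congr (_ * _); apply: eq_bigr => i _.
  by rewrite fourier_sum_mode_cos ?fourier_sum_mode_sin//; have := ltn_ord i; lia.
have sd := sqintB measurable_I su sS; have se := sqintB measurable_I sp sS.
have he : << (fun x => u x - fourier_sum M u x), (fun x => p x - fourier_sum M u x) >> = 0.
  by rewrite ipC ipBl// (ipC p _) hp (ipC (fourier_sum _ _) _) hS subrr.
have := ip_sqrB measurable_I sd se.
rewrite (_ : (fun x => _ - _ - _) = (fun x => u x - p x)); last by apply/funext => x; ring.
rewrite fourier_sum_dist// he mulr0 subr0 => ->.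
rewrite -mulrBr -ler_pdivlMl//.
have := @ip_ge0 _ I (fun x => p x - fourier_sum M u x); lra.
Qed.

End Fourier.

(** * Density of trigonometric polynomials and Parseval's identity *)

Section TrigDensity.
Import HBNNSimple.
Context {R : realType}.
Variables (T w : R).
Hypotheses (T0 : 0 < T) (wT : w * T = 2 * pi).
Local Notation mu := (@lebesgue_measure R).
Let I : set R := `[0, T].
Local Notation "'<<' u , v '>>'" := (ip I u v).
Implicit Types u v g p : R -> R.
Let measurable_I := @measurable_I R T.
Hint Resolve measurable_I : core.

Definition approximable u := sqint I u /\
  forall e : R, 0 < e -> exists2 p, trigpoly w p &
    << (fun x => u x - p x), (fun x => u x - p x) >> <= e.

Lemma approximable_trigpoly p : trigpoly w p -> approximable p.
Proof.
move=> tp; split; first exact: (sqint_trigpoly T0 tp).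
move=> e e0; exists p => //; under eq_fun do rewrite subrr.
by rewrite (ip0l measurable_I); exact: ltW.
Qed.

Lemma approximable_lim u : sqint I u ->
  (forall e : R, 0 < e -> exists2 v, approximable v &
     << (fun x => u x - v x), (fun x => u x - v x) >> <= e) -> approximable u.
Proof.
move=> su H; split=> // e e0; have e4 : 0 < e / 4 by rewrite divr_gt0.
have [v [sv Hv] uv] := H _ e4; have [p tp vp] := Hv _ e4.
exists p => //; have sp : sqint I p by exact: (sqint_trigpoly T0 tp).
have := ip_sqrD_le measurable_I (sqintB measurable_I su sv) (sqintB measurable_I sv sp).
rewrite (_ : (fun x => u x - v x + (v x - p x)) = (fun x => u x - p x)); last first.
  by apply/funext => x; ring.
by move=> h; apply: le_trans h _; lra.
Qed.

Lemma approximableD u v : approximable u -> approximable v ->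
  approximable (fun x => u x + v x).
Proof.
move=> [su Hu] [sv Hv]; split; first exact: sqintD.
move=> e e0; have e4 : 0 < e / 4 by rewrite divr_gt0.
have [p tp up] := Hu _ e4; have [q tq vq] := Hv _ e4.
have sp : sqint I p by exact: (sqint_trigpoly T0 tp).
have sq : sqint I q by exact: sqint_trigpoly tq.
exists (fun x => p x + q x); first exact: trigpoly_add.
have := ip_sqrD_le measurable_I (sqintB measurable_I su sp) (sqintB measurable_I sv sq).
rewrite (_ : (fun x => u x - p x + (v x - q x)) = (fun x => u x + v x - (p x + q x))); last first.
  by apply/funext => x; ring.
by move=> h; apply: le_trans h _; lra.
Qed.

Lemma trigpolyZ k p : trigpoly w p -> trigpoly w (fun x => k * p x).
Proof. by move=> tp; apply: trigpoly_mul => //; exact: trigpoly_cst. Qed.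

Lemma approximableZ k u : approximable u -> approximable (fun x => k * u x).
Proof.
move=> [su Hu]; split; first exact: sqintZ.
move=> e e0; have k1 : 0 < k ^+ 2 + 1 by rewrite ltr_wpDl ?sqr_ge0.
have [p tp up] := Hu _ (divr_gt0 e0 k1).
have sp : sqint I p by exact: (sqint_trigpoly T0 tp).
exists (fun x => k * p x); first exact: trigpolyZ.
have sup := sqintB measurable_I su sp.
rewrite (_ : (fun x => k * u x - k * p x) = (fun x => k * (u x - p x))); last first.
  by apply/funext => x; ring.
rewrite ipZl//; last exact: sqintZ.
rewrite ipC ipZl// mulrA -expr2.
move: up; rewrite ler_pdivlMr// mulrC => up; apply: le_trans up.
by rewrite ler_wpM2r ?ip_ge0// lerDl.
Qed.

Lemma approximable_dominated (N : set R) (u_ : nat -> R -> R) u g :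
  @measurable _ (measurableTypeR R) N -> mu N = 0%E ->
  (forall n, approximable (u_ n)) -> sqint I u -> sqint I g ->
  (forall x, I x -> ~ N x -> u_ n x @[n --> \oo] --> u x) ->
  (forall n x, I x -> `|u x - u_ n x| <= g x) ->
  approximable u.
Proof.
move=> mN N0 au su sg cvgu dom; apply: approximable_lim => // e e0.
have sun n : sqint I (u_ n) by case: (au n).
have [n H] := ip_dominated_cvg measurable_I mN N0 sun su sg cvgu dom e0.
by exists (u_ n) => //; exact: H.
Qed.

Lemma bernoulli_ineq (y : R) n : -1 <= y -> 1 + n%:R * y <= (1 + y) ^+ n.
Proof.
move=> y1; elim: n => [|n IH]; first by rewrite mul0r addr0 expr0.
rewrite exprS; have h : 0 <= 1 + y by lra.
apply: le_trans (ler_wpM2l h IH).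
have := mulr_ge0 (ler0n R n) (sqr_ge0 y); rewrite -natr1; lra.
Qed.

(** The function h(x) = 1/2 + sin(w x / 2) sin(w (x - c) / 2) / 2 is a
   trigonometric polynomial with values in [0, 1]. For 0 < x < T its first
   sine is positive, so that h is below 1/2 for x < c and above 1/2 for x >
   c. The polynomials (1 - h^n)^(2^n) therefore tend to the indicator of x <
   c, as in the elementary proofs of the Stone-Weierstrass theorem; both
   limits follow from Bernoulli's inequality. *)
Lemma approximable_itv t : approximable (\1_(`]-oo, t[)).
Proof.
have [c ct cT] : exists2 c : R, 0 <= c <= T & forall x, 0 < x < T -> (x < t) = (x < c).
  (* The point t, clamped to the period. *)
  exists (Num.max 0 (Num.min T t)).
    by rewrite le_max lexx/= ge_max (ltW T0)/= ge_min lexx.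
  by move=> x /andP[x0 xT]; rewrite lt_max (ltNge x 0) (ltW x0)/= lt_min xT.
pose h x := 2^-1 + 2^-1 * (sin (w * x / 2) * sin (w * (x - c) / 2)).
have th : trigpoly w h.
  rewrite (_ : h = fun x => (2^-1 + (4^-1 * cos (w * c / 2)) * mode_cos w 0 x) +
      ((- (4^-1 * cos (w * c / 2))) * mode_cos w 1 x + (- (4^-1 * sin (w * c / 2))) * mode_sin w 1 x)).
    do ![apply: trigpoly_add]; [exact: trigpoly_cst|exact: trigpoly_cos|exact: trigpoly_cos|exact: trigpoly_sin].
  apply/funext => x; rewrite mode_cos0 /h /mode_cos /mode_sin !mul1r.
  have -> : w * (x - c) / 2 = w * x / 2 - w * c / 2 by ring.
  set X := w * x / 2; have -> : w * x = X + X by rewrite /X; field.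
  rewrite sinB cosD sinD.
  have := cos2Dsin2 X; set C := cos _; set S := sin _ => CS.
  have -> : C * C = 1 - S ^+ 2 by rewrite -CS; ring.
  by field.
have h01 x : 0 <= h x <= 1.
  have := sin_max (w * x / 2); have := sin_max (w * (x - c) / 2).
  rewrite /h; set a := sin _; set b := sin _ => a1 b1.
  have : `|b * a| <= 1 by rewrite normrM mulr_ile1.
  by rewrite ler_norml => /andP[? ?]; apply/andP; split; lra.
pose u_ n x := (1 - h x ^+ n) ^+ (2 ^ n).
have tu n : trigpoly w (u_ n).
  apply: trigpoly_exp; rewrite (_ : (fun x => _) = fun x => 1 + (- 1) * h x ^+ n); last first.
    by apply/funext => x; rewrite mulN1r.
  by apply: trigpoly_add; [exact: trigpoly_cst|exact/trigpolyZ/trigpoly_exp].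
have u01 n x : 0 <= u_ n x <= 1.
  have /andP[h0 h1] := h01 x.
  have H0 : 0 <= h x ^+ n by rewrite exprn_ge0.
  have H1 : h x ^+ n <= 1 by rewrite exprn_ile1.
  by rewrite /u_ exprn_ge0 ?exprn_ile1//; lra.
have muIfin := measure_I_fin T0.
have m1 : measurable_fun I (\1_(`]-oo, t[) : R -> R) by exact: measurable_indic.
have i01 x : 0 <= (\1_(`]-oo, t[) : R -> R) x <= 1.
  by rewrite indicE; case: (_ \in _); rewrite /= ?lexx ?ler01.
(* The points where h = 1/2 and nothing is known of the limit. *)
pose N : set R := [set 0] `|` [set T] `|` [set c].
apply: (@approximable_dominated N u_ _ (fun=> 1)).
- by apply: measurableU => //; exact: measurableU.
- apply/eqP; rewrite eq_le measure_ge0 andbT.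
  have h1 : (mu N <= mu ([set 0%R] `|` [set T]) + mu [set c])%E.
    by apply: measureU2 => //; exact: measurableU.
  have h2 : (mu ([set 0%R] `|` [set T]) <= mu [set 0%R] + mu [set T])%E.
    exact: measureU2.
  apply: le_trans h1 _; rewrite [X in (_ + X)%E]lebesgue_measure_set1 adde0.
  by apply: le_trans h2 _; rewrite !lebesgue_measure_set1 adde0.
- by move=> n; exact: approximable_trigpoly.
- apply: (@sqint_bounded _ _ measurable_I _ 1) => // x _.
  by have /andP[a0 a1] := i01 x; rewrite ger0_norm.
- by apply: (@sqint_bounded _ _ measurable_I _ 1) => // x _; rewrite normr1.
- move=> x; rewrite /I/= in_itv/= => /andP[x0 xT] Nx.
  have {}x0 : 0 < x by rewrite lt_neqAle x0 andbT; apply/eqP => e; apply: Nx; left; left.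
  have {}xT : x < T by rewrite lt_neqAle xT andbT; apply/eqP => e; apply: Nx; left; right.
  have xc : x != c by apply/eqP => e; apply: Nx; right.
  have -> : (\1_(`]-oo, t[) : R -> R) x = (x < c)%R%:R.
    rewrite indicE -cT ?x0//; congr (nat_of_bool _)%:R.
    by apply/idP/idP; rewrite inE/= in_itv.
  have w0 : 0 < w by rewrite -(pmulr_lgt0 _ T0) wT mulr_gt0 ?pi_gt0.
  have s1 : 0 < sin (w * x / 2).
    apply: sin_gt0_pi; rewrite divr_gt0 ?mulr_gt0//= ltr_pdivrMr// [pi * 2]mulrC -wT.
    by rewrite ltr_pM2l.
  move: ct => /andP[c0 cT'].
  case: (ltgtP x c) xc => // xc _.
  + have s2 : 0 < sin (w * (c - x) / 2).
      apply: sin_gt0_pi; rewrite divr_gt0 ?mulr_gt0 ?subr_gt0//= ltr_pdivrMr// [pi * 2]mulrC -wT.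
      by rewrite ltr_pM2l//; lra.
    have hx : h x < 2^-1.
      rewrite /h (_ : w * (x - c) / 2 = - (w * (c - x) / 2)); last by ring.
      rewrite sinN mulrN; have := mulr_gt0 s1 s2; lra.
    have /andP[h0 h1] := h01 x.
    apply: (@squeeze_cvgr _ _ _ _ (fun n => 1 - (2 * h x) ^+ n) (fun=> 1)).
    * apply: nearW => n; have /andP[_ ->] := u01 n x; rewrite andbT.
      have := @bernoulli_ineq (- h x ^+ n) (2 ^ n).
      rewrite lerN2 exprn_ile1// => /(_ isT).
      by rewrite /u_ natrX mulrN -exprMn.
    * rewrite -[X in _ --> X]subr0; apply: cvgB; first exact: cvg_cst.
      by apply: cvg_expr; rewrite ger0_norm; lra.
    * exact: cvg_cst.
  + have s2 : 0 < sin (w * (x - c) / 2).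
      apply: sin_gt0_pi; rewrite divr_gt0 ?mulr_gt0 ?subr_gt0//= ltr_pdivrMr// [pi * 2]mulrC -wT.
      by rewrite ltr_pM2l//; lra.
    have hx : 2^-1 < h x by rewrite /h; have := mulr_gt0 s1 s2; lra.
    have /andP[h0 h1] := h01 x.
    apply: (@squeeze_cvgr _ _ _ _ (fun=> 0) (fun n => ((2 * h x)^-1) ^+ n)).
    * apply: nearW => n; have /andP[-> _] := u01 n x => /=.
      have y0 : 0 <= h x ^+ n by exact: exprn_ge0.
      have y1 : h x ^+ n <= 1 by exact: exprn_ile1.
      have B := @bernoulli_ineq (h x ^+ n) (2 ^ n).
      have {}B : (2 * h x) ^+ n <= (1 + h x ^+ n) ^+ (2 ^ n).
        rewrite exprMn -natrX; apply: le_trans (B _); last by lra.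
        by rewrite lerDr.
      have p0 : 0 < (2 * h x) ^+ n by apply: exprn_gt0; lra.
      rewrite exprVn -(ler_pM2r p0) mulVf ?gt_eqF//.
      apply: le_trans (_ : u_ n x * (1 + h x ^+ n) ^+ (2 ^ n) <= _).
        by rewrite ler_wpM2l//; have /andP[] := u01 n x.
      rewrite /u_ -exprMn exprn_ile1//.
        by apply: mulr_ge0; lra.
      by have := sqr_ge0 (h x ^+ n); lra.
    * exact: cvg_cst.
    * apply: cvg_expr; rewrite ger0_norm ?invr_ge0; last by lra.
      by rewrite invf_lt1; lra.
- move=> n x _; have /andP[a0 a1] := i01 x; have /andP[b0 b1] := u01 n x.
  by rewrite ler_norml; apply/andP; split; lra.
Qed.

Lemma approximable_cst c : approximable (fun=> c).
Proof. exact/approximable_trigpoly/trigpoly_cst. Qed.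

Lemma approximable_sum (J : Type) (s : seq J) (f : J -> R -> R) :
  (forall i, approximable (f i)) -> approximable (fun x => \sum_(i <- s) f i x).
Proof.
move=> af; elim: s => [|i s IH].
  by under eq_fun do rewrite big_nil; exact: approximable_cst.
by under eq_fun do rewrite big_cons; exact: approximableD.
Qed.

(** The sets with approximable indicator form a Dynkin system (disjoint
   unions by dominated convergence), and it contains the half-lines. *)
Lemma approximable_indic (A : set (measurableTypeR R)) : measurable A -> approximable (\1_A : R -> R).
Proof.
move=> mA.
have sq1 : sqint I (fun=> 1).
  by apply: (@sqint_bounded _ _ measurable_I _ 1) => // [|x _]; [exact: measure_I_fin|rewrite normr1].
have mE : @measurable _ (measurableTypeR R) = <<s @RGenInftyO.G R >>.
  exact: RGenInftyO.measurableE.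
have sqi (B : set (measurableTypeR R)) : measurable B -> sqint I (\1_B : R -> R).
  move=> mB; apply: (@sqint_bounded _ _ measurable_I _ 1) => // [|x _].
  - exact: measure_I_fin.
  - by rewrite indicE; case: (_ \in _); rewrite /= ?normr1 ?normr0.
apply: (@dynkin_induction _ (measurableTypeR R) (@RGenInftyO.G R)
   (fun A => approximable (\1_A : R -> R)) mE); last by rewrite -mE.
- move=> _ _ [x ->] [y ->]; exists (Num.min x y).
  by apply/seteqP; split => z /=; rewrite !in_itv/= lt_min; [move=> [-> ->]|move=> /andP[]].
- by rewrite indicT; exact: approximable_cst.
- by move=> _ [x ->]; exact: approximable_itv.
- move=> S mS aS; rewrite (_ : \1_(~` S) = fun x => 1 + -1 * \1_S x); last first.
    by apply/funext => x; rewrite !indicE in_setC; case: (x \in S) => /=; ring.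
  by apply: approximableD; [exact: approximable_cst|exact: approximableZ].
- move=> F mF tF aF.
  have E n x : \sum_(0 <= i < n) \1_(F i) x = (x \in \bigcup_(i in `I_n) F i)%:R :> R.
    case: (pselect (exists2 k, (k < n)%N & F k x)) => [[k kn Fkx]|nF].
      rewrite mem_set; last by exists k.
      rewrite big_mkord (bigD1 (Ordinal kn))//= big1 ?addr0; first by rewrite indicE mem_set.
      move=> i ik; rewrite indicE memNset// => Fix.
      move/eqP : ik; apply; apply/val_inj => /=.
      by apply: (tF i k) => //; exists x.
    rewrite memNset; last by move=> [k /= kn Fkx]; apply: nF; exists k.
    rewrite big_mkord big1// => i _; rewrite indicE memNset// => Fix.
    by apply: nF; exists i.
  have mU : @measurable _ (measurableTypeR R) (\bigcup_k F k) by exact: bigcup_measurable.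
  apply: (@approximable_dominated set0 (fun n x => \sum_(0 <= i < n) \1_(F i) x) _ (fun=> 1)) => //.
  + by move=> n; exact: approximable_sum.
  + exact: sqi.
  + move=> x _ _; apply: cvg_near_cst.
    case: (pselect (exists k, F k x)) => [[k Fkx]|nF].
      exists k.+1 => // n /= kn; rewrite E indicE !mem_set//; first by exists k.
      by exists k.
    apply: nearW => n; rewrite E indicE !memNset//; first by move=> [k _ Fkx]; apply: nF; exists k.
    by move=> [k _ Fkx]; apply: nF; exists k.
  + move=> n x _; rewrite E indicE.
    case: (boolP (x \in \bigcup_(i in `I_n) F i)) => [h|_].
      rewrite mem_set; first by rewrite subrr normr0.
      by move: h; rewrite inE => -[k _ Fkx]; exists k.
    by rewrite subr0 ger0_norm ?ler_nat; case: (_ \in _).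
Qed.

Lemma approximable_nnsfun (f : {nnsfun (measurableTypeR R) >-> R}) : approximable f.
Proof.
rewrite (_ : (f : R -> R) = fun x => \sum_(y <- finmap.enum_fset (fset_set (range f))) y * \1_(f @^-1` [set y]) x).
  apply: approximable_sum => y; apply: approximableZ; apply: approximable_indic.
  exact: measurable_sfunP.
by apply/funext => x; rewrite fimfunE fsbig_finite.
Qed.

(** Nonnegative u is a pointwise limit of simple functions that u dominates. *)
Lemma approximable_ge0 u : sqint I u -> (forall x, 0 <= u x) -> approximable u.
Proof.
move=> su u0.
have mu_ : @measurable_fun _ _ (measurableTypeR R) (\bar R) I (EFin \o u).
  by apply/measurable_EFinP; exact: su.1.
have u0' x : I x -> (0 <= (EFin \o u) x)%E by move=> _; rewrite lee_fin.
pose f n : R -> R := nnsfun_approx measurable_I mu_ n.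
have f_le n x : I x -> 0 <= f n x <= u x.
  move=> Ix; rewrite /f; apply/andP; split; first exact: fun_ge0.
  have E : nnsfun_approx measurable_I mu_ n x = approx I (EFin \o u) n x.
    exact: (congr1 (fun g => g x) (nnsfun_approxE measurable_I mu_ n)).
  by have := le_approx n u0' Ix; rewrite lee_fin E.
apply: (@approximable_dominated set0 f u u) => //.
- by move=> n; exact: approximable_nnsfun.
- move=> x Ix _; have := @cvg_nnsfun_approx _ _ _ _ measurable_I _ mu_ u0' x Ix.
  exact: (@fine_cvg _ _ _ _ _ (u x)).
- move=> n x Ix; have /andP[h1 h2] := f_le n x Ix.
  by rewrite ler_norml; apply/andP; split; lra.
Qed.

Lemma approximable_sqint u : sqint I u -> approximable u.
Proof.
move=> su.
have sn : sqint I (fun x => `|u x|).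
  split; first exact: measurableT_comp su.1.
  by have := su.2; congr (integrable _ _ _); apply/funext => x /=; rewrite real_normK ?num_real.
rewrite (_ : u = fun x => 2^-1 * (`|u x| + u x) + (- 2^-1) * (`|u x| - u x)).
  apply: approximableD; apply: approximableZ; apply: approximable_ge0.
  - exact: sqintD.
  - by move=> x; have := ler_norm (- u x); rewrite normrN; lra.
  - exact: sqintB.
  - by move=> x; have := ler_norm (u x); lra.
by apply/funext => x; field.
Qed.

(** The lower half of Parseval's identity; the upper half is bessel. *)
Lemma parseval u (e : R) : sqint I u -> 0 < e -> exists M0, forall M, (M0 <= M)%N ->
  T * << u, u >> - e <= energy T w M u.
Proof.
move=> su e0; have [_ /(_ _ (divr_gt0 e0 T0)) [p tp up]] := approximable_sqint su.
have [M0 H] := energy_approx T0 wT tp su; exists M0 => M /H; apply: le_trans.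
by rewrite lerD2l lerN2 mulrC -ler_pdivlMr.
Qed.

End TrigDensity.

(** * Translations and integration cell by cell *)

Section Translation.
Context {R : realType}.
Local Notation mu := (@lebesgue_measure R).
Implicit Types (f : R -> R) (c : R).

(** Translation with the Borel structure made explicit on both sides, as the
   pushforward of a measure requires. *)
Definition translate c : measurableTypeR R -> measurableTypeR R := fun x => x + c.

Lemma measurable_translate c : measurable_fun setT (translate c).
Proof. by apply: measurable_funD => //; exact: measurable_cst. Qed.

HB.instance Definition _ c :=
  isMeasurableFun.Build _ _ _ _ (translate c) (measurable_translate c).

(** The Lebesgue measure is determined by its values on bounded half-open
   intervals, and a translate of such an interval has the same length. *)
Lemma lebesgue_measure_translate c (A : set (measurableTypeR R)) : measurable A ->
  pushforward mu (translate c) A = mu A.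
Proof.
move=> mA; apply/esym.
have := @lebesgue_measure_unique R (pushforward mu (translate c)) _ A mA; apply=> // _ [[a b]] _ <-.
have e : translate c @^-1` `](a, b).1, (a, b).2]%classic = `]a - c, b - c]%classic.
  apply/seteqP; split => x /=; rewrite /translate !in_itv/= ltrBlDr lerBrDr//.
transitivity (mu (translate c @^-1` `](a, b).1, (a, b).2]%classic)) => //.
rewrite e !lebesgue_measure_itv/= !lte_fin ltrD2r; case: ifP => // _.
by rewrite -!EFinB; congr EFin; ring.
Qed.

Variables (c : R) (D : set (measurableTypeR R)).
Hypothesis mD : measurable D.
Let E : set (measurableTypeR R) := [set x | D (x + c)].

Lemma ge0_integral_shift (f : R -> \bar R) : measurable_fun setT f ->
  (forall x, 0 <= f x)%E ->
  (\int[mu]_(x in D) f x = \int[mu]_(x in E) f ((x : R) + c)%R)%E.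
Proof.
move=> mf f0; rewrite -(@ge0_integral_pushforward _ _ _ _ _ _ (measurable_translate c) mu D f) //.
  by apply: eq_measure_integral => A mA AD; apply: esym; exact: lebesgue_measure_translate.
exact: measurable_funTS.
Qed.

Lemma integrable_shift f : measurable_fun setT f -> mu.-integrable D (EFin \o f) ->
  mu.-integrable E (EFin \o (fun x => f (x + c))).
Proof.
move=> mf /integrableP[_ fi].
have mfc : measurable_fun setT (fun x : R => f (x + c)).
  by apply: measurableT_comp => //; exact: measurable_translate.
apply/integrableP; split; first by apply/measurable_EFinP/measurable_funTS.
rewrite -(@ge0_integral_shift (fun x => `|(f x)%:E|%E))//.
by apply: measurableT_comp => //; exact/measurable_EFinP.
Qed.

Lemma Rintegral_shift f : measurable_fun setT f -> mu.-integrable D (EFin \o f) ->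
  \int[mu]_(x in D) f x = \int[mu]_(x in E) f (x + c).
Proof.
move=> mf fi; have fE := integrable_shift mf fi.
rewrite /Rintegral; congr fine.
rewrite -(@integral_pushforward _ _ _ _ _ _ (measurable_translate c) mu D (EFin \o f)) //.
  by apply: eq_measure_integral => A mA AD; apply: esym; exact: lebesgue_measure_translate.
exact/measurable_EFinP.
Qed.

End Translation.

Section Periodization.
Context {R : realType}.
Local Notation mu := (@lebesgue_measure R).
Variables (T : R).
Hypotheses (T0 : 0 < T).
Let I : set R := `[0, T].
Implicit Types (f u v : R -> R) (L : nat).

Lemma shift_itv (a : R) : [set x | `[a, a + T]%classic (x + a)] = I.
Proof.
by apply/seteqP; split => x /=; rewrite /I/= !in_itv/=; lra.
Qed.

Lemma integrable_shift_itv f (a : R) : measurable_fun setT f ->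
  mu.-integrable `[a, a + T] (EFin \o f) -> mu.-integrable I (EFin \o (fun x => f (x + a))).
Proof.
move=> mf fi; have := @integrable_shift R a `[a, a + T] _ f mf fi.
by rewrite shift_itv; apply; exact: measurable_itv.
Qed.

Lemma Rintegral_split f (A : R) n : measurable_fun setT f ->
  mu.-integrable `[A, A + n%:R * T] (EFin \o f) ->
  \int[mu]_(x in `[A, A + n%:R * T]) f x =
  \sum_(i < n) \int[mu]_(x in I) f (x + (A + i%:R * T)).
Proof.
move=> mf; elim: n => [|n IH] fi.
  by rewrite big_ord0 mul0r addr0 set_itv1 Rintegral_set1.
have nT : A <= A + n%:R * T by rewrite lerDl mulr_ge0 ?ler0n// ltW.
have nS : A + n.+1%:R * T = A + n%:R * T + T by rewrite -natr1; ring.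
have nST : A + n%:R * T <= A + n.+1%:R * T by rewrite nS lerDl ltW.
rewrite big_ord_recr/= -IH; last first.
  by apply: integrableS fi => //; apply: subset_itvl; rewrite bnd_simp.
have := @Rintegral_itvB R f (BLeft A) (BRight (A + n.+1%:R * T)) (A + n%:R * T) fi.
rewrite !bnd_simp => /(_ nT nST) /eqP; rewrite subr_eq addrC => /eqP ->.
congr (_ + _); rewrite Rintegral_itv_obnd_cbnd; last first.
  by apply: integrableS fi => //; apply: subset_itvr; rewrite bnd_simp.
rewrite nS (@Rintegral_shift R (A + n%:R * T))//; first by rewrite shift_itv.
apply: integrableS fi => //; rewrite nS; apply: subset_itvr; by rewrite bnd_simp.
Qed.

Definition supported L u := forall x, L%:R * T < `|x| -> u x = 0.

(** Left endpoint of the i-th of the 2 L cells of length T into which [- L T,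
   L T] is divided. *)
Definition cell_shift (L i : nat) : R := (i%:R - L%:R) * T.

Lemma Rintegral_supported f L : measurable_fun setT f -> mu.-integrable setT (EFin \o f) ->
  supported L f ->
  \int[mu]_x f x = \sum_(i < 2 * L) \int[mu]_(x in I) f (x + cell_shift L i).
Proof.
move=> mf fi fL.
have -> : \int[mu]_x f x = \int[mu]_(x in `[- (L%:R * T), L%:R * T]) f x.
  rewrite [RHS]Rintegral_mkcond; apply: eq_Rintegral => x _; rewrite patchE.
  case: ifPn => // /negP xI; apply: fL; rewrite ltNge; apply/negP => xL; apply: xI.
  by rewrite inE/= in_itv/= -ler_norml.
have e : L%:R * T = - (L%:R * T) + (2 * L)%:R * T by rewrite natrM; ring.
rewrite [X in `[_, X]]e Rintegral_split//; last by rewrite -e; apply: integrableS fi.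
by apply: eq_bigr => i _; apply: eq_Rintegral => x _; congr f; rewrite /cell_shift; ring.
Qed.

Lemma sqint_setT_shift u (c : R) : sqint setT u -> sqint I (fun x => u (x + c)).
Proof.
move=> [mu_ iu]; split.
  apply: measurable_funTS; apply: (measurableT_comp mu_); exact: measurable_translate.
have mu2 : measurable_fun setT (fun x => u x ^+ 2) by exact: measurable_funX.
apply: (@integrable_shift_itv (fun x => u x ^+ 2) c mu2).
by apply: integrableS iu => //; exact: measurable_itv.
Qed.

Lemma ip_supported u v L : sqint setT u -> sqint setT v -> supported L u ->
  ip setT u v = \sum_(i < 2 * L) ip I (fun x => u (x + cell_shift L i)) (fun x => v (x + cell_shift L i)).
Proof.
move=> su sv uL; rewrite /ip (@Rintegral_supported _ L)//.
- exact: measurable_funM su.1 sv.1.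
- exact: sqint_mul.
- by move=> x /uL ->; rewrite mul0r.
Qed.

End Periodization.

(** * Extrema of the Zak sums, and Parseval's identity on the circle *)

Section ZakCompact.
Context {R : realType}.
Variables (b : R) (J q : nat).

(** Encodes common zeros: this sum of squared moduli vanishes exactly where
   all q Zak sums Z(y - r/q, t) do. *)
Definition zaksum (yt : R * R) : R := \sum_(r < q)
  (zakc b J yt.2 (yt.1 - r%:R / q%:R) ^+ 2 + zaks b J yt.2 (yt.1 - r%:R / q%:R) ^+ 2).

Lemma continuous_tent : continuous (tent b : R -> R).
Proof.
move=> x; apply: (@continuous_max _ _ (cst 0) (fun y : R => b - `|y|)).
  exact: cvg_cst.
by apply: cvgB; [exact: cvg_cst|exact: norm_continuous].
Qed.

Lemma continuous_zaksum : continuous zaksum.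
Proof.
have P1 (c : R) (g : R -> R) (i : 'I_(2 * J).+1) : continuous g -> continuous (fun yt : R * R =>
    tent b (yt.1 - c + (i%:Z - J%:Z)%:~R) * g ((i%:Z - J%:Z)%:~R * yt.2)).
  move=> cg x; apply: cvgM.
    apply: (@continuous_comp _ _ _ (fun yt : R * R => yt.1 - c + (i%:Z - J%:Z)%:~R) (tent b)); last exact: continuous_tent.
    by apply: cvgD; [apply: cvgB; [exact: cvg_fst|exact: cvg_cst]|exact: cvg_cst].
  apply: (@continuous_comp _ _ _ (fun yt : R * R => (i%:Z - J%:Z)%:~R * yt.2) g); last exact: cg.
  by apply: cvgZr; exact: cvg_snd.
have sumC (n : nat) (f : 'I_n -> R * R -> R) : (forall i, continuous (f i)) ->
    continuous (fun x => \sum_(i < n) f i x).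
  elim: n f => [|n IH] f cf x.
    rewrite (_ : (fun _ => _) = cst 0); first exact: cvg_cst.
    by apply/funext => y; rewrite big_ord0.
  rewrite (_ : (fun _ => _) = fun y => \sum_(i < n) f (widen_ord (leqnSn n) i) y + f ord_max y).
    by apply: cvgD; [apply: IH => i; exact: cf|exact: cf].
  by apply/funext => y; rewrite big_ord_recr.
apply: (@sumC q) => r x; apply: cvgD; rewrite /GRing.exp/=.
  by apply: cvgM; apply: (@sumC (2 * J).+1) => i; apply: P1; exact: continuous_cos.
by apply: cvgM; apply: (@sumC (2 * J).+1) => i; apply: P1; exact: continuous_sin.
Qed.

Let K : set (R * R) := `[0, 1] `*` `[0, 2 * pi].

(** That the lower bound is attained makes it positive as soon as zaksum has
   no zero. *)
Lemma zaksum_bounds : exists m0 M0 : R,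
  [/\ m0 <= M0, (exists y t : R, [/\ 0 <= y <= 1, 0 <= t <= 2 * pi & m0 = zaksum (y, t)]) &
  forall y t : R, 0 <= y <= 1 -> 0 <= t <= 2 * pi -> m0 <= zaksum (y, t) <= M0].
Proof.
have pi0 : 0 <= 2 * pi :> R by rewrite mulr_ge0// pi_ge0.
have K0 : K !=set0 by exists (0, 0); split; rewrite /= in_itv/= ?lexx ?ler01 ?pi0.
have cK : compact K by apply: compact_setX; exact: segment_compact.
have cf : {within K, continuous zaksum}.
  by apply: continuous_subspaceT => x; exact: continuous_zaksum.
have [[y1 t1] c1 h1] := compact_EVT_min K0 cK cf.
have [[y2 t2] c2 h2] := compact_EVT_max K0 cK cf.
exists (zaksum (y1, t1)), (zaksum (y2, t2)).
have inK (y t : R) : 0 <= y <= 1 -> 0 <= t <= 2 * pi -> (y, t) \in K.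
  by move=> hy ht; rewrite inE; split; rewrite /= in_itv.
split.
- exact: h2.
- by move: c1; rewrite inE => -[/=]; rewrite !in_itv/= => a1 a2; exists y1, t1.
- by move=> y t hy ht; rewrite h1 ?h2// inK.
Qed.

End ZakCompact.

Section PolyEnergy.
Context {R : realType}.
Implicit Types (p q : {poly R}) (t : R).

(** Real and imaginary parts of the value of p at e^(it). *)
Definition pcos p t := \sum_(i < size p) p`_i * cos (i%:R * t).
Definition psin p t := \sum_(i < size p) p`_i * sin (i%:R * t).
Definition pabs2 p t := pcos p t ^+ 2 + psin p t ^+ 2.

Lemma expi_exp t n : expi t ^+ n = expi (n%:R * t) :> R[i].
Proof.
elim: n => [|n IH]; first by rewrite expr0 mul0r /expi cos0 sin0.
rewrite exprS IH -natr1 mulrDl mul1r /expi addrC cosD sinD.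
by apply/eqP; rewrite eq_complex/=; apply/andP; split; apply/eqP; ring.
Qed.

Lemma horner_expi p t : (map_poly (real_complex R) p).[expi t] = (pcos p t +i* psin p t)%C.
Proof.
rewrite horner_coef size_map_poly /pcos /psin.
have H n (f g : nat -> R) : \sum_(i < n) (f i +i* g i)%C =
    ((\sum_(i < n) f i) +i* (\sum_(i < n) g i))%C.
  elim: n => [|n IH]; first by rewrite !big_ord0.
  by rewrite !big_ord_recr/= IH; apply/eqP; rewrite eq_complex/= !eqxx.
rewrite -(H _ (fun i => p`_i * cos (i%:R * t)) (fun i => p`_i * sin (i%:R * t))).
apply: eq_bigr => i _; rewrite coef_map/= expi_exp.
by apply/eqP; rewrite eq_complex/= !mul0r subr0 addr0 !eqxx.
Qed.

(** The squared modulus on the circle is multiplicative because evaluation at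
   e^(it) in R[i] is. *)
Lemma pabs2M p q t : pabs2 (p * q) t = pabs2 p t * pabs2 q t.
Proof.
rewrite /pabs2; have := horner_expi (p * q) t; rewrite rmorphM hornerM !horner_expi => -[<- <-].
ring.
Qed.

Lemma pcosE p t n : (size p <= n)%N -> pcos p t = \sum_(i < n) p`_i * cos (i%:R * t).
Proof.
move=> pn; rewrite /pcos (big_ord_widen n (fun i => p`_i * cos (i%:R * t)))// big_mkcond.
by apply: eq_bigr => i _; case: ltnP => // h; rewrite nth_default// mul0r.
Qed.
Lemma psinE p t n : (size p <= n)%N -> psin p t = \sum_(i < n) p`_i * sin (i%:R * t).
Proof.
move=> pn; rewrite /psin (big_ord_widen n (fun i => p`_i * sin (i%:R * t)))// big_mkcond.
by apply: eq_bigr => i _; case: ltnP => // h; rewrite nth_default// mul0r.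
Qed.

Variables (T w : R).
Hypotheses (T0 : 0 < T) (wT : w * T = 2 * pi).
Local Notation mu := (@lebesgue_measure R).
Let I : set R := `[0, T].

Lemma integrable_pabs2 p : mu.-integrable I (EFin \o (fun x => pabs2 p (w * x))).
Proof.
have sc : sqint I (fun x => pcos p (w * x)).
  by apply: (sqint_sum (measurable_I T)) => i; apply: (sqintZ (measurable_I T)); exact: (@sqint_mode_cos R T w T0 i%:Z).
have ss : sqint I (fun x => psin p (w * x)).
  by apply: (sqint_sum (measurable_I T)) => i; apply: (sqintZ (measurable_I T)); exact: (@sqint_mode_sin R T w T0 i%:Z).
by have := integrableD (measurable_I T) sc.2 ss.2; apply: eq_integrable => //; exact: measurable_I.
Qed.

Lemma Rint_pabs2 p n : (size p <= n)%N ->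
  \int[mu]_(x in I) pabs2 p (w * x) = T * \sum_(i < n) p`_i ^+ 2.
Proof.
move=> pn; have measurable_I := @measurable_I R T.
have s1 n' := @sqint_mode_cos R T w T0 n'; have s2 n' := @sqint_mode_sin R T w T0 n'.
have sc (i : nat) : sqint I (fun x => p`_i * mode_cos w i%:Z x) by apply: sqintZ => //; exact: s1.
have ss (i : nat) : sqint I (fun x => p`_i * mode_sin w i%:Z x) by apply: sqintZ => //; exact: s2.
pose C x := \sum_(i < n) p`_i * mode_cos w i%:Z x.
pose S x := \sum_(i < n) p`_i * mode_sin w i%:Z x.
have sC : sqint I C by exact: (sqint_sum measurable_I).
have sS : sqint I S by exact: (sqint_sum measurable_I).
transitivity (ip I C C + ip I S S).
  rewrite /ip -RintegralD//; [|exact: sqint_mul..].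
  by apply: eq_Rintegral => x _; rewrite /pabs2 (pcosE _ pn) (psinE _ pn) !expr2.
rewrite !ip_suml// -big_split/= mulr_sumr; apply: eq_bigr => i _.
rewrite (ipC _ C) (ipC _ S) !ip_suml// -big_split/= (bigD1 i)//= big1 ?addr0.
  rewrite !ipZl//.
  rewrite !(ipC (mode_cos _ _)) !(ipC (mode_sin _ _)) !ipZl//.
  rewrite ip_cc// ip_ss// eqxx; case: eqP => _ /=; field => //.
move=> j ji; rewrite !ipZl//.
rewrite !(ipC (mode_cos _ _)) !(ipC (mode_sin _ _)) !ipZl//.
rewrite ip_cc// ip_ss// (negbTE (_ : (i%:Z != j%:Z))) ?eqz_nat 1?eq_sym//; case: eqP => _ /=; field => //.
Qed.

End PolyEnergy.

(** * Gabor coefficients of compactly supported real functions *)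

(** Closing estimate of coef_sqr_lower: tu, tv are squared norms of
   truncations, du, dv those of the tails, and G1, G2, G3 are the sums of
   coef_sqr over one box for the truncations, for the tails and for the
   functions themselves. *)
Lemma lower_arith (R : realFieldType) (A B N tu tv du dv bu bv G1 G2 G3 : R) :
  0 <= N -> N = tu + du + (tv + dv) -> (A + 2 * B) * (du + dv) <= A * N / 4 ->
  A * tu - A * N / 8 <= bu -> A * tv - A * N / 8 <= bv -> bu + bv = G1 ->
  G2 <= B * (du + dv) -> G1 <= 2 * G3 + 2 * G2 -> A / 4 * N <= G3.
Proof.
move=> N0 NE hD k1 k2 S1 U S2.
have k5 : A * N = A * tu + A * tv + A * (du + dv) by rewrite NE; ring.
have hD' : A * (du + dv) + 2 * (B * (du + dv)) <= A * N / 4 by move: hD; rewrite mulrDl mulrA.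
clear NE hD; lra.
Qed.

Section GaborReal.
Context {R : realType}.
Local Notation mu := (@lebesgue_measure R).
Variables (q : nat) (a b : R) (J : nat).
Hypotheses (q0 : (0 < q)%N) (b1 : 1 <= b) (ab : a * b = 1 / q%:R) (bJ : b <= J%:R).
Implicit Types (u : R -> R) (L M : nat) (k : int).

Let T : R := b^-1.
Let w : R := 2 * pi * b.
Let I : set R := `[0, T].

Let b0 : 0 < b. Proof. exact: lt_le_trans b1. Qed.
Let T0 : 0 < T. Proof. by rewrite invr_gt0. Qed.
Let wT : w * T = 2 * pi. Proof. by rewrite /w /T mulfK// gt_eqF. Qed.
Let q0' : 0 < q%:R :> R. Proof. by rewrite ltr0n. Qed.
Let aq : a * q%:R = T.
Proof.
have e : a = T / q%:R.
  by rewrite /T mulrC -[LHS](mulfK (lt0r_neq0 b0)) ab div1r.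
by rewrite e divfK// gt_eqF.
Qed.
Let a0 : 0 < a. Proof. by move: T0; rewrite -aq pmulr_lgt0. Qed.
Let JT : 1 <= J%:R * T. Proof. by rewrite /T ler_pdivlMr// mul1r. Qed.

Let measurable_I := @measurable_I R T.
Hint Resolve measurable_I : core.

Local Notation win := (tent (1 : R)).

Lemma measurable_win D (c : R) : measurable_fun D (fun x : R => win (x - c)).
Proof.
apply: measurable_funTS; apply: continuous_measurable_fun => x.
apply: (@continuous_comp _ _ _ (fun x : R => x - c) win); last exact: continuous_tent.
by apply: cvgB; [exact: cvg_id|exact: cvg_cst].
Qed.

Lemma win01 x : 0 <= win x <= 1.
Proof.
rewrite /tent le_max lexx/= ge_max ler01/=; have := normr_ge0 x; lra.
Qed.

Lemma win_norm x : `|win x| <= 1.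
Proof. by have /andP[h1 h2] := win01 x; rewrite ger0_norm. Qed.

Definition atom_cos k n (x : R) := win (x - a * k%:~R) * mode_cos w n x.
Definition atom_sin k n (x : R) := win (x - a * k%:~R) * mode_sin w n x.
Definition coef_cos u k n := ip setT u (atom_cos k n).
Definition coef_sin u k n := ip setT u (atom_sin k n).

Lemma win_eq0 x : 1 <= `|x| -> win x = 0.
Proof. exact: tent_eq0. Qed.

Lemma sqint_atom k n : sqint setT (atom_cos k n) /\ sqint setT (atom_sin k n).
Proof.
pose D : set R := `[a * k%:~R - 1, a * k%:~R + 1]%classic.
have mD : @measurable _ (measurableTypeR R) D by exact: measurable_itv.
have Dfin : (mu D < +oo)%E.
  by rewrite /D lebesgue_measure_itv/=; case: ifP => _; rewrite ltry.
have H (e : R -> R) : measurable_fun setT e -> (forall x, `|e x| <= 1) ->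
    sqint setT (fun x => win (x - a * k%:~R) * e x).
  move=> me e1; pose f x := win (x - a * k%:~R) * e x.
  have mf : measurable_fun setT f by apply: measurable_funM => //; exact: measurable_win.
  split => //.
  have : sqint D f.
    apply: (@sqint_bounded _ _ mD _ 1) => //; first exact: measurable_funTS.
    by move=> x _; rewrite normrM mulr_ile1// win_norm.
  move=> [_ iD].
  have := (@integrable_mkcond _ (measurableTypeR R) R mu D (fun x => (f x ^+ 2)%:E) mD).1 iD.
  congr (integrable _ _ _); apply/funext => x /=; rewrite patchE; case: ifPn => // /negP xD.
  rewrite /f win_eq0 ?mul0r ?expr0n//.
  rewrite leNgt; apply/negP => h; apply: xD; rewrite inE /D/= in_itv/=.
  by move: h; rewrite ltr_norml => /andP[? ?]; apply/andP; split; lra.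
split; apply: H.
- exact: measurable_mode_cos.
- by move=> x; exact: cos_max.
- exact: measurable_mode_sin.
- by move=> x; exact: sin_max.
Qed.

(** The value at x in [0, T] of the T-periodization of u times the k-th
   translated window. The sum over 2 L cells is all of it when u is
   supported in [- L T, L T]. *)
Definition periodization L u k x := \sum_(i < 2 * L)
  win (x + cell_shift T L i - a * k%:~R) * u (x + cell_shift T L i).

Lemma sqint_periodization L u k : sqint setT u -> sqint I (periodization L u k).
Proof.
move=> su; apply: (sqint_sum measurable_I) => i; apply: (sqintM_bounded (C := 1) measurable_I).
- exact: sqint_setT_shift.
- apply: measurable_funTS.
  have := @measurable_win setT (a * k%:~R - cell_shift T L i).
  by under eq_fun do rewrite opprB addrA.
- by move=> x _; exact: win_norm.
Qed.

Lemma mode_cos_shift n L i x : mode_cos w n (x + cell_shift T L i) = mode_cos w n x /\ mode_sin w n (x + cell_shift T L i) = mode_sin w n x.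
Proof.
rewrite /mode_cos /mode_sin.
have -> : n%:~R * (w * (x + cell_shift T L i)) = n%:~R * (w * x) + (n * (i%:Z - L%:Z))%:~R * (2 * pi).
  by rewrite -wT intrM intrB /cell_shift /=; ring.
by rewrite cosD sinD; have [-> ->] := @cos_period R (n * (i%:Z - L%:Z)); split; ring.
Qed.

(** The modulations take the same values on all cells, so the integral over
   the line is an integral of the periodization over one cell. *)
Lemma coef_periodization L u k n : sqint setT u -> supported T L u ->
  coef_cos u k n = ip I (periodization L u k) (mode_cos w n) /\ coef_sin u k n = ip I (periodization L u k) (mode_sin w n).
Proof.
move=> su uL; have [sc ss] := sqint_atom k n.
have s1 := @sqint_mode_cos R T w T0 n; have s2 := @sqint_mode_sin R T w T0 n.
have st (i : 'I_(2 * L)) : sqint I (fun x => win (x + cell_shift T L i - a * k%:~R) * u (x + cell_shift T L i)).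
  apply: (sqintM_bounded (C := 1) measurable_I).
  - exact: sqint_setT_shift.
  - apply: measurable_funTS.
    have := @measurable_win setT (a * k%:~R - cell_shift T L i).
    by under eq_fun do rewrite opprB addrA.
  - by move=> x _; exact: win_norm.
rewrite /coef_cos /coef_sin !(ip_supported T0 (L := L))// /periodization !ip_suml//.
split; apply: eq_bigr => i _; apply: eq_Rintegral => x _.
  by rewrite /atom_cos (mode_cos_shift _ _ _ _).1; ring.
by rewrite /atom_sin (mode_cos_shift _ _ _ _).2; ring.
Qed.

(** For fixed x, the samples of u on x + T Z (sample_poly) and those of the
   r-th window (window_poly). The latter are stored in reverse order, which
   turns the sums in periodization_conv into coefficients of a product. *)
Definition sample_poly L u x : {poly R} := \poly_(i < 2 * L) u (x + cell_shift T L i).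
Definition window_poly (r : nat) x : {poly R} :=
  \poly_(j < (2 * J).+1) win (x - a * r%:R + (J%:R - j%:R) * T).

(** The translation indices are written k = q l' + r with l' = l - (L + J),
   because then a k = l' T + r a. The range l < 2 (L + J) contains all the
   indices for which the translated window meets [- L T, L T]. *)
Definition lattice_index L (l r : nat) : int := q%:Z * (l%:Z - (L + J)%:Z) + r%:Z.

(** By the choice of lattice_index the translated window, sampled in the i-th
   cell, depends on i - l only, so that the sum over the cells is a
   convolution. *)
Lemma periodization_conv L u x l r : I x -> (r < q)%N -> periodization L u (lattice_index L l r) x = (sample_poly L u x * window_poly r x)`_l.
Proof.
rewrite /I/= in_itv/= => /andP[x0 xT] rq.
have r1 : r%:R + 1 <= q%:R :> R by rewrite natr1 ler_nat.
have [ar1 ar2] : 0 <= a * r%:R /\ a * r%:R + a <= T.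
  split; first by rewrite mulr_ge0// ltW.
  by rewrite -aq -[X in _ + X]mulr1 -mulrDr ler_pM2l.
have JT' := JT; have a0' := a0; have T0' := T0.
rewrite coefM.
pose F (i : nat) := win (x - a * r%:R + (J%:R + i%:R - l%:R) * T) * u (x + cell_shift T L i).
have E (i : nat) : win (x + cell_shift T L i - a * (lattice_index L l r)%:~R) = win (x - a * r%:R + (J%:R + i%:R - l%:R) * T).
  congr win; rewrite /lattice_index intrD intrM intrB -!pmulrn natrD /cell_shift.
  have -> : a * (q%:R * (l%:R - (L%:R + J%:R)) + r%:R) = (a * q%:R) * (l%:R - (L%:R + J%:R)) + a * r%:R by ring.
  by rewrite aq; ring.
have F0 (i : nat) : (l < i)%N -> F i = 0.
  move=> li; rewrite /F win_eq0 ?mul0r//.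
  have h : l%:R + 1 <= i%:R :> R by rewrite natr1 ler_nat.
  have h2 : (J%:R + 1) * T <= (J%:R + i%:R - l%:R) * T by rewrite ler_pM2r//; lra.
  rewrite ger0_norm; lra.
transitivity (\sum_(i < l.+1) if (i < 2 * L)%N then F i else 0); last first.
  apply: eq_bigr => i _; rewrite !coef_poly; case: (ltnP i (2 * L)) => h; last by rewrite mul0r.
  rewrite /F mulrC; congr (_ * _).
  have il : (i <= l)%N by rewrite -ltnS.
  case: ltnP => h2; first by rewrite natrB//; congr win; ring.
  rewrite win_eq0//.
  have h3 : (2 * J)%:R + 1 <= (l - i)%:R :> R by rewrite natr1 ler_nat.
  rewrite natrB// natrM in h3.
  have h4 : (J%:R + i%:R - l%:R) * T <= - (J%:R + 1) * T by rewrite ler_pM2r//; lra.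
  rewrite ler0_norm; lra.
rewrite /periodization; under eq_bigr => i _ do rewrite E.
rewrite -/(F _) -(big_mkord xpredT F) -(big_mkord xpredT (fun i => if (i < 2 * L)%N then F i else 0)).
pose n := maxn (2 * L) l.+1.
have -> : \sum_(0 <= i < 2 * L) F i = \sum_(0 <= i < n) if (i < 2 * L)%N then F i else 0.
  rewrite (big_cat_nat (n := 2 * L) (p := n))//=; last exact: leq_maxl.
  rewrite [X in _ = _ + X]big_nat_cond [X in _ = _ + X]big1 ?addr0.
    by rewrite !big_nat; apply: eq_bigr => i /andP[_ ->].
  by move=> i /andP[/andP[h _] _]; rewrite ltnNge h.
rewrite (big_cat_nat (n := l.+1) (p := n))//=; last exact: leq_maxr.
rewrite [X in _ + X]big_nat_cond [X in _ + X]big1 ?addr0// => i /andP[/andP[h _] _].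
by rewrite F0// if_same.
Qed.

(** Scaling by b turns samples of the window at spacing T into samples of
   tent b at spacing 1. Reversing the order of the samples and numbering
   them from 0 conjugates the sum and multiplies it by e^(i J t), which does
   not affect its modulus. *)
Lemma window_poly_zak x t (r : nat) : pabs2 (window_poly r x) t =
  b ^- 2 * (zakc b J t (b * x - r%:R / q%:R) ^+ 2 + zaks b J t (b * x - r%:R / q%:R) ^+ 2).
Proof.
have bT : b * T = 1 by rewrite /T divff// gt_eqF.
have ar : a * r%:R = T * (r%:R / q%:R) by rewrite -aq; field; rewrite gt_eqF.
have tentE (i : nat) : tent b (b * x - r%:R / q%:R + (i%:Z - J%:Z)%:~R) =
    b * win (x - a * r%:R + (i%:R - J%:R) * T).
  rewrite /tent maxr_pMr ?(ltW b0)// mulr0 mulrBr mulr1; congr (Num.max 0 (b - _)).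
  transitivity (`|b * (x - a * r%:R + (i%:R - J%:R) * T)|); last by rewrite normrM (gtr0_norm b0).
  congr `|_|.
  rewrite intrB /= ar.
  have -> : b * (x - T * (r%:R / q%:R) + (i%:R - J%:R) * T) =
     b * x - (b * T) * (r%:R / q%:R) + (i%:R - J%:R) * (b * T) by ring.
  by rewrite bT; ring.
pose g (i : nat) := win (x - a * r%:R + (i%:R - J%:R) * T).
pose C := \sum_(i < (2 * J).+1) g i * cos ((i%:Z - J%:Z)%:~R * t).
pose S := \sum_(i < (2 * J).+1) g i * sin ((i%:Z - J%:Z)%:~R * t).
have -> : zakc b J t (b * x - r%:R / q%:R) = b * C.
  by rewrite mulr_sumr; apply: eq_bigr => i _; rewrite tentE mulrA.
have -> : zaks b J t (b * x - r%:R / q%:R) = b * S.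
  by rewrite mulr_sumr; apply: eq_bigr => i _; rewrite tentE mulrA.
have co (j : 'I_(2 * J).+1) : (window_poly r x)`_((2 * J).+1 - j.+1) = g j.
  rewrite coef_poly (ltn_ord (rev_ord j)) /g; congr win; rewrite subSS natrB; last by rewrite -ltnS.
  by rewrite natrM; ring.
have an (j : 'I_(2 * J).+1) : ((2 * J).+1 - j.+1)%:R * t = J%:R * t - (j%:Z - J%:Z)%:~R * t.
  rewrite subSS natrB; last by rewrite -ltnS.
  by rewrite natrM intrB /=; ring.
have sz : (size (window_poly r x) <= (2 * J).+1)%N by exact: size_poly.
have -> : pabs2 (window_poly r x) t = (cos (J%:R * t) * C + sin (J%:R * t) * S) ^+ 2 +
    (sin (J%:R * t) * C - cos (J%:R * t) * S) ^+ 2.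
  rewrite /pabs2 (pcosE _ sz) (psinE _ sz) (reindex_inj rev_ord_inj)/= [in X in _ + X](reindex_inj rev_ord_inj)/=.
  congr (_ ^+ 2 + _ ^+ 2).
    rewrite !mulr_sumr -big_split/=; apply: eq_bigr => j _.
    by rewrite co an cosB; ring.
  rewrite !mulr_sumr -sumrB; apply: eq_bigr => j _.
  by rewrite co an sinB; ring.
have cs := cos2Dsin2 (J%:R * t); move: cs; set c := cos _; set s := sin _ => cs.
have -> : (c * C + s * S) ^+ 2 + (s * C - c * S) ^+ 2 = (c ^+ 2 + s ^+ 2) * (C ^+ 2 + S ^+ 2) by ring.
by rewrite cs; field; rewrite gt_eqF.
Qed.

Lemma integrableZ_EFin c (f : R -> R) : mu.-integrable I (EFin \o f) ->
  mu.-integrable I (EFin \o (fun x => c * f x)).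
Proof. by move=> fi; have := integrableZl measurable_I c fi; apply: eq_integrable. Qed.

Lemma Rint_sum (n : nat) (f : nat -> R -> R) :
  (forall i, (i < n)%N -> mu.-integrable I (EFin \o f i)) ->
  mu.-integrable I (EFin \o (fun x => \sum_(i < n) f i x)) /\
  \int[mu]_(x in I) (\sum_(i < n) f i x) = \sum_(i < n) \int[mu]_(x in I) f i x.
Proof.
elim: n => [|n IH] fi.
  rewrite big_ord0 (_ : (fun x => _) = fun=> 0); last by apply/funext => x; rewrite big_ord0.
  by split; [exact: integrable0|rewrite Rintegral_cst// mul0r].
have [|i1 e1] := IH; first by move=> i h; apply: fi; exact: ltnW.
have i2 := fi n (ltnSn n).
rewrite (_ : (fun x => _) = (fun x => \sum_(i < n) f i x + f n x)); last first.
  by apply/funext => x; rewrite big_ord_recr.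
split; first exact: (integrableD measurable_I i1 i2).
by rewrite RintegralD// e1 big_ord_recr.
Qed.

(** By periodization_conv, the sum over all relevant k of the squared
   periodizations at x. *)
Definition fiber_energy L u x := \sum_(r < q) \sum_(l < 2 * (L + J)) (sample_poly L u x * window_poly r x)`_l ^+ 2.

(** Parseval's identity on the circle expresses the squared coefficients of
   the products through |C|^2 |G_r|^2, where C and G_r are the polynomials
   of samples. The sum of |G_r|^2 over r is b^-2 zaksum, a factor that lies
   between the two bounds pointwise. *)
Lemma fiber_energy_bounds (m0 M0 : R) L u x : I x ->
  (forall y t : R, 0 <= y <= 1 -> 0 <= t <= 2 * pi -> m0 <= zaksum b J q (y, t) <= M0) ->
  b ^- 2 * m0 * (\sum_(i < 2 * L) u (x + cell_shift T L i) ^+ 2) <= fiber_energy L u x <=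
  b ^- 2 * M0 * (\sum_(i < 2 * L) u (x + cell_shift T L i) ^+ 2).
Proof.
move=> Ix bnd; set N := \sum_(i < 2 * L) _; set S := fiber_energy L u x.
have /andP[x0 xT] : 0 <= x <= T by move: Ix; rewrite /I/= in_itv.
have sz (r : nat) : (size (sample_poly L u x * window_poly r x)%R <= 2 * (L + J))%N.
  apply: leq_trans (size_polyMleq _ _) _.
  have := size_poly (2 * L) (fun i => u (x + cell_shift T L i)).
  have := size_poly (2 * J).+1 (fun j => win (x - a * r%:R + (J%:R - j%:R) * T)).
  rewrite -/(window_poly r x) -/(sample_poly L u x); lia.
have szC : (size (sample_poly L u x) <= 2 * L)%N by exact: size_poly.
have NE : T * N = \int[mu]_(t in I) pabs2 (sample_poly L u x) (w * t).
  rewrite (Rint_pabs2 T0 wT szC); congr (_ * _); apply: eq_bigr => i _.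
  by rewrite coef_poly ltn_ord.
have SE : T * S = \int[mu]_(t in I) (\sum_(r < q) pabs2 (sample_poly L u x * window_poly r x) (w * t)).
  have [|_ ->] := @Rint_sum q (fun r t => pabs2 (sample_poly L u x * window_poly r x) (w * t)).
    by move=> r _; exact: integrable_pabs2.
  by rewrite mulr_sumr; apply: eq_bigr => r _; rewrite (Rint_pabs2 T0 wT (sz r)).
have iS : mu.-integrable I (EFin \o (fun t => \sum_(r < q) pabs2 (sample_poly L u x * window_poly r x) (w * t))).
  by apply: (@Rint_sum q (fun r t => pabs2 (sample_poly L u x * window_poly r x) (w * t)) _).1 => r _; exact: integrable_pabs2.
have iN := @integrable_pabs2 R T w T0 (sample_poly L u x).
have iNc c : mu.-integrable I (EFin \o (fun t => c * pabs2 (sample_poly L u x) (w * t))).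
  exact: integrableZ_EFin.
have pw t : I t -> b ^- 2 * m0 * pabs2 (sample_poly L u x) (w * t) <=
   \sum_(r < q) pabs2 (sample_poly L u x * window_poly r x) (w * t) <= b ^- 2 * M0 * pabs2 (sample_poly L u x) (w * t).
  rewrite /I/= in_itv/= => /andP[t0 tT].
  have -> : \sum_(r < q) pabs2 (sample_poly L u x * window_poly r x) (w * t) =
      b ^- 2 * zaksum b J q (b * x, w * t) * pabs2 (sample_poly L u x) (w * t).
    rewrite /zaksum mulr_sumr mulr_suml; apply: eq_bigr => r _.
    by rewrite pabs2M window_poly_zak/= mulrC.
  have p0 : 0 <= pabs2 (sample_poly L u x) (w * t) by rewrite addr_ge0// sqr_ge0.
  have b2 : 0 <= b ^- 2 by rewrite invr_ge0 sqr_ge0.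
  have w0 : 0 <= w by rewrite /w !mulr_ge0// ?pi_ge0// ltW.
  have hy : 0 <= b * x <= 1.
    rewrite mulr_ge0 ?(ltW b0)//=; move: xT; rewrite /T -(ler_pM2l b0) divff// gt_eqF//.
  have ht : 0 <= w * t <= 2 * pi by rewrite mulr_ge0//= -wT ler_wpM2l.
  have /andP[h1 h2] := bnd _ _ hy ht.
  by rewrite !(ler_wpM2r p0)// ler_wpM2l.
apply/andP; split; rewrite -(ler_pM2l T0).
  rewrite mulrCA NE SE -RintegralZl//; apply: le_Rintegral => // t /pw /andP[] //.
rewrite [leRHS]mulrCA NE SE -RintegralZl//; apply: le_Rintegral => // t /pw /andP[] //.
Qed.

(** The squared coefficients of u summed over all relevant translations and
   the modulations |m| <= M. *)
Definition box_energy M L u := \sum_(l < 2 * (L + J)) \sum_(r < q) energy T w M (periodization L u (lattice_index L l r)).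

Lemma Rint_fiber_energy L u : sqint setT u ->
  mu.-integrable I (EFin \o fiber_energy L u) /\
  \int[mu]_(x in I) fiber_energy L u x =
   \sum_(l < 2 * (L + J)) \sum_(r < q) ip I (periodization L u (lattice_index L l r)) (periodization L u (lattice_index L l r)).
Proof.
move=> su; rewrite exchange_big/=.
have fE x : I x -> fiber_energy L u x = \sum_(r < q) \sum_(l < 2 * (L + J)) periodization L u (lattice_index L l r) x ^+ 2.
  move=> Ix; apply: eq_bigr => r _; apply: eq_bigr => l _.
  by rewrite periodization_conv.
have i1 (r : nat) := @Rint_sum (2 * (L + J)) (fun l x => periodization L u (lattice_index L l r) x ^+ 2)
   (fun l _ => (sqint_periodization L (lattice_index L l r) su).2).
have [i2 e2] := @Rint_sum q (fun r x => \sum_(l < 2 * (L + J)) periodization L u (lattice_index L l r) x ^+ 2)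
   (fun r _ => (i1 r).1).
split.
  by move: i2; apply: eq_integrable => // x /[!inE] Ix /=; rewrite fE.
transitivity (\int[mu]_(x in I) \sum_(r < q) \sum_(l < 2 * (L + J)) periodization L u (lattice_index L l r) x ^+ 2).
  by apply: eq_Rintegral => x /[!inE] Ix; exact: fE.
rewrite e2; apply: eq_bigr => r _; rewrite (i1 r).2; apply: eq_bigr => l _.
by rewrite /ip; apply: eq_Rintegral => x _; rewrite expr2.
Qed.

Lemma box_energy_le_fiber M L u : sqint setT u -> box_energy M L u <= T * \int[mu]_(x in I) fiber_energy L u x.
Proof.
move=> su; rewrite (Rint_fiber_energy L su).2 mulr_sumr; apply: ler_sum => l _.
rewrite mulr_sumr; apply: ler_sum => r _; apply: (bessel T0 wT); exact: sqint_periodization.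
Qed.

(** Parseval's identity in each of the finitely many indices (l, r), with the
   error divided evenly among them. *)
Lemma box_energy_ge_fiber L u (e : R) : sqint setT u -> 0 < e -> exists M0, forall M, (M0 <= M)%N ->
  T * (\int[mu]_(x in I) fiber_energy L u x) - e <= box_energy M L u.
Proof.
move=> su e0; rewrite (Rint_fiber_energy L su).2.
pose K := (2 * (L + J) * q)%N.
have K0 : 0 < K%:R + 1 :> R by rewrite ltr_wpDl.
have e1 : 0 < e / (K%:R + 1) by rewrite divr_gt0.
have H l r := parseval T0 wT (sqint_periodization L (lattice_index L l r) su) e1.
pose F (l : 'I_(2 * (L + J))) (r : 'I_q) := projT1 (cid (H l r)).
have FP l r M : (F l r <= M)%N -> T * ip I (periodization L u (lattice_index L l r)) (periodization L u (lattice_index L l r)) - e / (K%:R + 1) <=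
    energy T w M (periodization L u (lattice_index L l r)).
  exact: (projT2 (cid (H l r))).
exists (\max_l \max_r F l r) => M MM.
apply: le_trans (_ : \sum_(l < 2 * (L + J)) \sum_(r < q)
   (T * ip I (periodization L u (lattice_index L l r)) (periodization L u (lattice_index L l r)) - e / (K%:R + 1)) <= _).
  under [leRHS]eq_bigr => l _ do rewrite sumrB sumr_const card_ord.
  rewrite sumrB sumr_const card_ord -mulrnA -/K mulr_sumr.
  under eq_bigr => l _ do rewrite mulr_sumr.
  apply: lerB => //.
  rewrite -[leLHS]mulr_natr mulrAC ler_pdivrMr// ler_pM2l// (_ : (q * _)%N = K) ?lerDl//.
  by rewrite mulnC.
apply: ler_sum => l _; apply: ler_sum => r _; apply: FP.
apply: leq_trans MM; apply: leq_trans (leq_bigmax_cond _ _) => //.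
exact: (leq_bigmax_cond (F := fun r => F l r)).
Qed.

Lemma ip_samples L u : sqint setT u -> supported T L u ->
  mu.-integrable I (EFin \o (fun x => \sum_(i < 2 * L) u (x + cell_shift T L i) ^+ 2)) /\
  ip setT u u = \int[mu]_(x in I) \sum_(i < 2 * L) u (x + cell_shift T L i) ^+ 2.
Proof.
move=> su uL; rewrite (ip_supported T0 su su uL).
have [|h1 h2] := @Rint_sum (2 * L) (fun i x => u (x + cell_shift T L i) ^+ 2).
  by move=> i _; have [_ h] := @sqint_setT_shift R T u (cell_shift T L i) su; exact: h.
split=> //; rewrite h2; apply: eq_bigr => i _; apply: eq_Rintegral => x _.
Qed.

Lemma box_energy_bounds (m0 M0 : R) L u : sqint setT u -> supported T L u ->
  (forall y t : R, 0 <= y <= 1 -> 0 <= t <= 2 * pi -> m0 <= zaksum b J q (y, t) <= M0) ->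
  (forall M, box_energy M L u <= T * (b ^- 2 * M0) * ip setT u u) /\
  (forall e, 0 < e -> exists M1, forall M, (M1 <= M)%N ->
    T * (b ^- 2 * m0) * ip setT u u - e <= box_energy M L u).
Proof.
move=> su uL bnd; have [iN eN] := ip_samples su uL; have [iF _] := Rint_fiber_energy L su.
have iNc c : mu.-integrable I (EFin \o (fun x => c * \sum_(i < 2 * L) u (x + cell_shift T L i) ^+ 2)).
  exact: integrableZ_EFin.
split=> [M|e e0].
  apply: le_trans (box_energy_le_fiber M L su) _; rewrite -mulrA ler_pM2l// eN -RintegralZl//.
  by apply: le_Rintegral => // x Ix; have /andP[] := fiber_energy_bounds L u Ix bnd.
have [M1 H] := box_energy_ge_fiber L su e0; exists M1 => M /H; apply: le_trans.
rewrite lerD2r -mulrA ler_pM2l// eN -RintegralZl//.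
by apply: le_Rintegral => // x Ix; have /andP[] := fiber_energy_bounds L u Ix bnd.
Qed.

(** * Frame bounds for arbitrary real and imaginary parts *)

(** The squared modulus of the coefficient of u + i v at the element p =
   (modulation, translation) of the Gabor system. *)
Definition coef_sqr u v (p : int * int) : R :=
  (coef_cos u p.2 p.1 + coef_sin v p.2 p.1) ^+ 2 + (coef_cos v p.2 p.1 - coef_sin u p.2 p.1) ^+ 2.

Lemma coef_sqr_ge0 u v p : 0 <= coef_sqr u v p.
Proof. by rewrite addr_ge0// sqr_ge0. Qed.

Definition box_index M L (p : 'I_(2 * M).+1 * ('I_(2 * (L + J)) * 'I_q)) : int * int :=
  (p.1%:Z - M%:Z, lattice_index L p.2.1 p.2.2).

Definition box_seq M L : seq (int * int) :=
  map (@box_index M L) (enum {: 'I_(2 * M).+1 * ('I_(2 * (L + J)) * 'I_q)}).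

Lemma box_seq_uniq M L : uniq (box_seq M L).
Proof.
rewrite map_inj_uniq ?enum_uniq// => -[i [l r]] [i' [l' r']] /= [e1 e2].
have ei : i = i' by apply/val_inj => /=; lia.
move: e2; rewrite /lattice_index => e2.
have e3 : (q * l + r = q * l' + r')%N by have := q0; nia.
have er : (r = r' :> nat).
  by have := congr1 (fun n => (n %% q)%N) e3; rewrite /= ![(q * _)%N]mulnC !modnMDl !modn_small.
have el : (l = l' :> nat).
  by have := congr1 (fun n => (n %/ q)%N) e3; rewrite /= ![(q * _)%N]mulnC !divnMDl// !divn_small// !addn0.
by rewrite ei (val_inj er) (val_inj el).
Qed.

Lemma sum_box_seq M L (F : int * int -> R) :
  \sum_(p <- box_seq M L) F p =
  \sum_(l < 2 * (L + J)) \sum_(r < q) \sum_(i < (2 * M).+1) F (i%:Z - M%:Z, lattice_index L l r).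
Proof.
rewrite big_map big_enum/= -(pair_bigA _ (fun (i : 'I_(2 * M).+1) (p : 'I_(2 * (L + J)) * 'I_q) =>
  F (i%:Z - M%:Z, lattice_index L p.1 p.2)))/= exchange_big/=.
by rewrite -(pair_bigA _ (fun (l : 'I_(2 * (L + J))) (r : 'I_q) => \sum_(i < (2 * M).+1) F (i%:Z - M%:Z, lattice_index L l r))).
Qed.

Lemma mem_box_seq M L (p : int * int) : (`|p.1| <= M)%N -> (`|p.2| <= L)%N -> (0 < J)%N ->
  p \in box_seq M L.
Proof.
case: p => m k /= mM kL J0.
pose n : nat := `|(k + q%:Z * (L + J)%:Z)%R|%N.
have nE : n%:Z = k + q%:Z * (L + J)%:Z by rewrite /n; have := q0; nia.
have n2 : (n < q * (2 * (L + J)))%N by have := q0; nia.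
have hl : (n %/ q < 2 * (L + J))%N by rewrite ltn_divLR// mulnC.
have hr : (n %% q < q)%N by rewrite ltn_mod.
have hi : (`|(m + M%:Z)%R| < (2 * M).+1)%N by lia.
apply/mapP; exists (Ordinal hi, (Ordinal hl, Ordinal hr)); first by rewrite mem_enum.
congr (_, _) => /=; first by lia.
rewrite /lattice_index; have := divn_eq n q => e.
have e' : n%:Z = (n %/ q)%:Z * q%:Z + (n %% q)%:Z by rewrite {1}e PoszD PoszM.
have -> : k = n%:Z - q%:Z * (L + J)%:Z by rewrite nE; ring.
by rewrite e'; ring.
Qed.

Lemma sum_subseq (s s' : seq (int * int)) (F : int * int -> R) :
  (forall p, 0 <= F p) -> uniq s -> uniq s' -> {subset s <= s'} ->
  \sum_(p <- s) F p <= \sum_(p <- s') F p.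
Proof.
move=> F0 us us' ss'.
rewrite [leRHS](bigID (mem s))/= -[leLHS]addr0; apply: lerD; last exact: sumr_ge0.
rewrite -[leRHS]big_filter le_eqVlt; apply/orP; left; apply/eqP; apply: perm_big.
apply: uniq_perm => //; first exact: filter_uniq.
by move=> x; rewrite mem_filter/=; case: (boolP (x \in s)) => //= /ss' ->.
Qed.

Lemma coef_opp u k n : coef_cos u k (- n) = coef_cos u k n /\
  (sqint setT u -> coef_sin u k (- n) = - coef_sin u k n).
Proof.
split; first by rewrite /coef_cos /atom_cos mode_cosN.
move=> su; have [_ ss] := sqint_atom k n.
rewrite /coef_sin (_ : atom_sin k (- n) = fun x => -1 * atom_sin k n x); last first.
  by apply/funext => x; rewrite /atom_sin mode_sinN; ring.
by rewrite ipC ipZl// mulN1r ipC.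
Qed.

(** The cross terms between u and v are odd in the modulation index and
   cancel in a symmetric sum, which decouples the two functions. *)
Lemma sum_coef_sqr M k u v : sqint setT u -> sqint setT v ->
  \sum_(i < (2 * M).+1) coef_sqr u v (i%:Z - M%:Z, k) =
  \sum_(i < (2 * M).+1) (coef_cos u k (i%:Z - M%:Z) ^+ 2 + coef_sin u k (i%:Z - M%:Z) ^+ 2) +
  \sum_(i < (2 * M).+1) (coef_cos v k (i%:Z - M%:Z) ^+ 2 + coef_sin v k (i%:Z - M%:Z) ^+ 2).
Proof.
move=> su sv; set S := LHS.
have SE : S = \sum_(i < (2 * M).+1) coef_sqr u v (- (i%:Z - M%:Z), k).
  by rewrite (sum_sym_opp (fun n => coef_sqr u v (n, k))).
suff : S + S = 2 * (\sum_(i < (2 * M).+1) (coef_cos u k (i%:Z - M%:Z) ^+ 2 + coef_sin u k (i%:Z - M%:Z) ^+ 2) +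
  \sum_(i < (2 * M).+1) (coef_cos v k (i%:Z - M%:Z) ^+ 2 + coef_sin v k (i%:Z - M%:Z) ^+ 2)) by lra.
rewrite {2}SE /S -!big_split/= mulr_sumr; apply: eq_bigr => i _.
set n := i%:Z - M%:Z; rewrite /coef_sqr /=.
rewrite !(coef_opp _ _ _).1 !((coef_opp _ _ _).2)//; ring.
Qed.

Lemma sum_box_seq_coef_sqr M L u v : sqint setT u -> sqint setT v ->
  supported T L u -> supported T L v ->
  \sum_(p <- box_seq M L) coef_sqr u v p = box_energy M L u + box_energy M L v.
Proof.
move=> su sv uL vL; rewrite sum_box_seq /box_energy -big_split/=; apply: eq_bigr => l _.
rewrite -big_split/=; apply: eq_bigr => r _; rewrite sum_coef_sqr//; congr (_ + _).
  by apply: eq_bigr => i _; have [-> ->] := coef_periodization (lattice_index L l r) (i%:Z - M%:Z) su uL.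
by apply: eq_bigr => i _; have [-> ->] := coef_periodization (lattice_index L l r) (i%:Z - M%:Z) sv vL.
Qed.

Definition truncation L u (x : R) : R := \1_(`[- (L%:R * T), L%:R * T]) x * u x.

Lemma truncationE L u x : truncation L u x = if `|x| <= L%:R * T then u x else 0.
Proof.
rewrite /truncation indicE; case: ifPn => h.
  by rewrite mem_set ?mul1r//= in_itv/= -ler_norml.
by rewrite memNset ?mul0r//= in_itv/= -ler_norml; exact/negP.
Qed.

Lemma supported_truncation L u : supported T L (truncation L u).
Proof. by move=> x h; rewrite truncationE leNgt h. Qed.

Lemma sqint_truncation L u : sqint setT u -> sqint setT (truncation L u).
Proof.
move=> su; apply: (sqintM_bounded (C := 1) measurableT) => //.
by move=> x _; rewrite indicE; case: (_ \in _); rewrite /= ?normr1 ?normr0.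
Qed.

(** The window of index k lives on [a k - 1, a k + 1] and does not see the
   truncation if this interval is inside [- L T, L T]. *)
Lemma coef_truncation (K L : nat) u k n : (`|k| <= K)%N -> a * K%:R + 1 <= L%:R * T ->
  coef_cos (truncation L u) k n = coef_cos u k n /\ coef_sin (truncation L u) k n = coef_sin u k n.
Proof.
move=> kK KL; have a0' := a0.
have H x : truncation L u x * win (x - a * k%:~R) = u x * win (x - a * k%:~R).
  rewrite truncationE; case: ifPn => // /negP xL; rewrite win_eq0 ?mulr0//.
  rewrite leNgt; apply/negP => h; apply: xL; apply: le_trans KL.
  have : `|a * k%:~R| <= a * K%:R :> R.
    rewrite normrM (gtr0_norm a0) ler_pM2l// -intr_norm -abszE.
    by rewrite -pmulrn ler_nat.
  have := ler_normD (x - a * k%:~R) (a * k%:~R); rewrite subrK; lra.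
split; apply: eq_Rintegral => x _; rewrite /atom_cos /atom_sin !mulrA H//.
Qed.

Lemma norm_truncation L u : sqint setT u ->
  ip setT (truncation L u) (truncation L u) + ip setT (fun x => u x - truncation L u x) (fun x => u x - truncation L u x)
   = ip setT u u.
Proof.
move=> su; have st := sqint_truncation L su; have sd := sqintB (measurableT) su st.
rewrite /ip -RintegralD//; try exact: sqint_mul.
by apply: eq_Rintegral => x _; rewrite truncationE; case: ifP => _; ring.
Qed.

Lemma tail_truncation u (e : R) : sqint setT u -> 0 < e -> exists L0, forall L, (L0 <= L)%N ->
  ip setT (fun x => u x - truncation L u x) (fun x => u x - truncation L u x) <= e.
Proof.
move=> su e0.
have sn : sqint setT (fun x => `|u x|).
  split; first exact: measurableT_comp su.1.
  by have := su.2; congr (integrable _ _ _); apply/funext => x /=; rewrite real_normK ?num_real.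
apply: (@ip_dominated_cvg R setT _ set0 (fun L => truncation L u) u (fun x => `|u x|)) => //.
- by move=> L; exact: sqint_truncation.
- move=> x _ _; apply: cvg_near_cst.
  exists (Num.truncn (`|x| * b)).+1 => // n /= h; rewrite truncationE.
  have -> // : `|x| <= n%:R * T.
  have /andP[_ h1] := truncn_itv (mulr_ge0 (normr_ge0 x) (ltW b0)).
  rewrite /T ler_pdivlMr//; apply: le_trans (ltW h1) _; by rewrite ler_nat.
- move=> L x _; rewrite truncationE; case: ifP => _; first by rewrite subrr normr0.
  by rewrite subr0.
Qed.

Lemma coef_sqr_split u1 v1 u2 v2 p : sqint setT u1 -> sqint setT v1 -> sqint setT u2 -> sqint setT v2 ->
  coef_sqr (fun x => u1 x + u2 x) (fun x => v1 x + v2 x) p <= 2 * coef_sqr u1 v1 p + 2 * coef_sqr u2 v2 p.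
Proof.
move=> h1 h2 h3 h4; case: p => m k; rewrite /coef_sqr/=; have [sc ss] := sqint_atom k m.
rewrite /coef_cos /coef_sin !ipDl//.
set A1 := ip _ u1 _; set A2 := ip _ u2 _; set B1 := ip _ v1 _; set B2 := ip _ v2 _.
set C1 := ip _ v1 _; set C2 := ip _ v2 _; set D1 := ip _ u1 _; set D2 := ip _ u2 _.
have := sqr_ge0 (A1 + B1 - (A2 + B2)); have := sqr_ge0 (C1 - D1 - (C2 - D2)).
by move=> e1 e2; nra.
Qed.

Section Bounds.
Variables (m0 M0 : R).
Hypothesis bnd : forall y t : R, 0 <= y <= 1 -> 0 <= t <= 2 * pi -> m0 <= zaksum b J q (y, t) <= M0.
Let B0 := T * (b ^- 2 * M0).
Let A0 := T * (b ^- 2 * m0).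

Lemma M0_ge0 : 0 <= M0.
Proof.
have pi0 : 0 <= 2 * pi :> R by rewrite mulr_ge0// pi_ge0.
have h0 : 0 <= (0 : R) <= 1 by rewrite lexx ler01.
have h1 : 0 <= (0 : R) <= 2 * pi by rewrite lexx pi0.
have /andP[_] := bnd h0 h1; apply: le_trans.
by apply: sumr_ge0 => r _; rewrite addr_ge0// sqr_ge0.
Qed.

Lemma B0_ge0 : 0 <= B0.
Proof. by rewrite !mulr_ge0 ?M0_ge0 ?invr_ge0 ?sqr_ge0// ltW. Qed.

(** A finite set of indices lies in a box and, by coef_truncation, a far
   enough truncation does not change the corresponding coefficients. So the
   bound for compactly supported functions is enough. *)
Lemma coef_sqr_upper (s : seq (int * int)) u v : sqint setT u -> sqint setT v -> uniq s ->
  \sum_(p <- s) coef_sqr u v p <= B0 * (ip setT u u + ip setT v v).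
Proof.
move=> su sv us.
pose K := \max_(p <- s) maxn `|p.1|%N `|p.2|%N.
have KP p : p \in s -> (`|p.1| <= K)%N /\ (`|p.2| <= K)%N.
  move=> ps; have : (maxn `|p.1|%N `|p.2|%N <= K)%N by exact: leq_bigmax_seq.
  by rewrite geq_max => /andP[].
have J0 : (0 < J)%N by rewrite -(ltr_nat R); apply: lt_le_trans bJ.
pose L := maxn K (Num.truncn ((a * K%:R + 1) * b)).+1.
have KL : a * K%:R + 1 <= L%:R * T.
  have h : 0 <= (a * K%:R + 1) * b by rewrite mulr_ge0 ?addr_ge0 ?mulr_ge0// ltW.
  have /andP[_ h1] := truncn_itv h.
  rewrite /T ler_pdivlMr//; apply: le_trans (ltW h1) _; by rewrite ler_nat leq_maxr.
have st := sqint_truncation L su; have stv := sqint_truncation L sv.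
apply: le_trans (_ : \sum_(p <- s) coef_sqr (truncation L u) (truncation L v) p <= _).
  rewrite le_eqVlt; apply/orP; left; apply/eqP; apply: eq_big_seq => p ps.
  have [_ pK] := KP p ps; rewrite /coef_sqr.
  by have [-> ->] := coef_truncation u p.1 pK KL; have [-> ->] := coef_truncation v p.1 pK KL.
apply: le_trans (_ : \sum_(p <- box_seq K L) coef_sqr (truncation L u) (truncation L v) p <= _).
  apply: sum_subseq => //; [by move=> p; exact: coef_sqr_ge0|exact: box_seq_uniq|].
  move=> p /KP[p1 p2]; apply: mem_box_seq => //; apply: leq_trans p2 _; exact: leq_maxl.
rewrite sum_box_seq_coef_sqr//; try exact: supported_truncation.
have [hu _] := box_energy_bounds st (@supported_truncation L u) bnd.
have [hv _] := box_energy_bounds stv (@supported_truncation L v) bnd.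
apply: le_trans (lerD (hu K) (hv K)) _; rewrite -mulrDr ler_wpM2l ?B0_ge0//.
rewrite -(norm_truncation L su) -(norm_truncation L sv).
by apply: lerD; rewrite lerDl ip_ge0.
Qed.

Hypothesis m0_gt0 : 0 < m0.

Lemma A0_gt0 : 0 < A0.
Proof. by rewrite !mulr_gt0// invr_gt0 exprn_gt0. Qed.

(** Almost all of the norm is carried by a truncation, to which the lower
   bound for compactly supported functions applies. It passes to u and v by
   (s + t)^2 <= 2 s^2 + 2 t^2, where the coefficients of the tails are
   controlled by coef_sqr_upper; this costs a constant factor. *)
Lemma coef_sqr_lower u v : sqint setT u -> sqint setT v -> exists2 s : seq (int * int), uniq s &
  A0 / 4 * (ip setT u u + ip setT v v) <= \sum_(p <- s) coef_sqr u v p.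
Proof.
move=> su sv; set N := ip setT u u + ip setT v v.
have N0 : 0 <= N by rewrite addr_ge0// ip_ge0.
have := N0; rewrite le_eqVlt => /predU1P[<-|Npos].
  by exists [::] => //; rewrite mulr0 big_nil.
have Ap := A0_gt0; have Bp := B0_ge0.
pose D := A0 + 2 * B0.
have Dp : 0 < D by rewrite /D; lra.
(* Chosen so that D * (2 * e) = A0 * N / 4, the slack of lower_arith. *)
pose e := A0 / (8 * D) * N.
have ep : 0 < e by rewrite /e mulr_gt0// divr_gt0// mulr_gt0.
have [L1 H1] := tail_truncation su ep; have [L2 H2] := tail_truncation sv ep.
pose L := maxn L1 L2.
have h1 := H1 L (leq_maxl _ _); have h2 := H2 L (leq_maxr _ _).
have e4 : 0 < A0 * N / 8 by rewrite divr_gt0// mulr_gt0.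
have st := sqint_truncation L su; have stv := sqint_truncation L sv.
have sd := sqintB (measurableT) su st; have sdv := sqintB (measurableT) sv stv.
have [_ /(_ _ e4) [M1 K1]] := box_energy_bounds st (@supported_truncation L u) bnd.
have [_ /(_ _ e4) [M2 K2]] := box_energy_bounds stv (@supported_truncation L v) bnd.
pose M := maxn M1 M2.
have k1 := K1 M (leq_maxl _ _); have k2 := K2 M (leq_maxr _ _).
exists (box_seq M L); first exact: box_seq_uniq.
have S1 : box_energy M L (truncation L u) + box_energy M L (truncation L v) = \sum_(p <- box_seq M L) coef_sqr (truncation L u) (truncation L v) p.
  by rewrite sum_box_seq_coef_sqr//; exact: supported_truncation.
have U := coef_sqr_upper sd sdv (box_seq_uniq M L).
have S2 : \sum_(p <- box_seq M L) coef_sqr (truncation L u) (truncation L v) p <=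
   2 * (\sum_(p <- box_seq M L) coef_sqr u v p) + 2 * \sum_(p <- box_seq M L) coef_sqr (fun x => u x - truncation L u x) (fun x => v x - truncation L v x) p.
  rewrite !mulr_sumr -big_split/=; apply: ler_sum => p _.
  have E w' : truncation L w' = fun x => w' x + -1 * (w' x - truncation L w' x).
    by apply/funext => x; ring.
  rewrite [in leLHS]E [in X in coef_sqr _ X _]E.
  have sN (w' : R -> R) : sqint setT w' -> sqint setT (fun x => -1 * w' x) by move=> ?; exact: sqintZ.
  apply: le_trans (@coef_sqr_split u v (fun x => -1 * (u x - truncation L u x)) (fun x => -1 * (v x - truncation L v x)) p su sv (sN _ sd) (sN _ sdv)) _.
  rewrite lerD2l ler_pM2l// le_eqVlt; apply/orP; left; apply/eqP.
  have [sc ss] := sqint_atom p.2 p.1.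
  by rewrite /coef_sqr /coef_cos /coef_sin !ipZl//; ring.
have nu := norm_truncation L su; have nv := norm_truncation L sv.
move: h1 h2 k1 k2 S1 U S2 nu nv; rewrite -/A0.
set tu := ip setT (truncation L u) _; set tv := ip setT (truncation L v) _.
set du := ip setT (fun x => u x - _) _; set dv := ip setT (fun x => v x - _) _.
set bu := box_energy M L _; set bv := box_energy M L _.
set G1 := \sum_(p <- _) coef_sqr (truncation _ _) _ _; set G2 := \sum_(p <- _) coef_sqr _ _ p; set G3 := \sum_(p <- _) _.
move=> h1 h2 k1 k2 S1 U S2 nu nv.
have De : D * (2 * e) = A0 * N / 4 by rewrite /e; field; rewrite gt_eqF.
have hD : D * (du + dv) <= A0 * N / 4 by rewrite -De ler_pM2l//; lra.
have NE : N = tu + du + (tv + dv) by rewrite /N nu nv.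
exact: (lower_arith (ltW Npos) NE hD k1 k2 S1 U S2).
Qed.

End Bounds.

(** * Trains of bumps at a common zero *)

(** For the other translation indices the window misses [- L T, L T]. *)
Lemma coef_sqr_eq0 L u v (p : int * int) : supported T L u -> supported T L v ->
  p.2 \notin [seq lattice_index L lr.1 lr.2 | lr : 'I_(2 * (L + J)) * 'I_q] -> coef_sqr u v p = 0.
Proof.
case: p => m k /= uL vL kout; have JT' := JT; have T0' := T0.
have far x : `|x| <= L%:R * T -> 1 <= `|x - a * k%:~R|.
  move=> xL; move: (xL); rewrite ler_norml => /andP[xl xr].
  case: (lerP (q%:Z * (L + J)%:Z) k) => hk.
    have : a * (q%:Z * (L + J)%:Z)%:~R <= a * k%:~R :> R by rewrite ler_pM2l// ler_int.
    rewrite intrM -!pmulrn mulrA aq natrD => h.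
    rewrite ler0_norm; lra.
  case: (ltrP k (- (q%:Z * (L + J)%:Z))) => hk2.
    have : a * k%:~R <= a * (- (q%:Z * (L + J)%:Z))%:~R :> R by rewrite ler_pM2l// ler_int ltW.
    rewrite intrN intrM -!pmulrn mulrN mulrA aq natrD => h.
    rewrite ger0_norm; lra.
  case/negP: kout.
  pose n : nat := `|(k + q%:Z * (L + J)%:Z)%R|%N.
  have nE : n%:Z = k + q%:Z * (L + J)%:Z by rewrite /n; clear -hk2; lia.
  have n2 : (n < q * (2 * (L + J)))%N by clear -hk nE; lia.
  have hl : (n %/ q < 2 * (L + J))%N by rewrite ltn_divLR// mulnC.
  have hr : (n %% q < q)%N by rewrite ltn_mod.
  apply/mapP; exists (Ordinal hl, Ordinal hr); first by rewrite mem_enum.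
  rewrite /lattice_index /=; have := divn_eq n q => e.
  have e' : n%:Z = (n %/ q)%:Z * q%:Z + (n %% q)%:Z by rewrite {1}e PoszD PoszM.
  have -> : k = n%:Z - q%:Z * (L + J)%:Z by rewrite nE; ring.
  by rewrite e'; ring.
have H (h e : R -> R) : supported T L h -> ip setT h (fun x => win (x - a * k%:~R) * e x) = 0.
  move=> hL; rewrite -[RHS](ip0l measurableT e) /ip; apply: eq_Rintegral => x _.
  case: (lerP `|x| (L%:R * T)) => xL; last by rewrite hL// !mul0r.
  by rewrite win_eq0 ?far// !mul0r mulr0.
by rewrite /coef_sqr /coef_cos /coef_sin /= !H// addr0 subr0 expr0n/= addr0.
Qed.

Lemma coef_sqr_sum_le_box_energy (s : seq (int * int)) L u v : sqint setT u -> sqint setT v ->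
  supported T L u -> supported T L v -> uniq s ->
  exists M, \sum_(p <- s) coef_sqr u v p <= box_energy M L u + box_energy M L v.
Proof.
move=> su sv uL vL us; pose M := \max_(p <- s) `|p.1|%N; exists M.
rewrite -sum_box_seq_coef_sqr//.
rewrite (bigID (mem (box_seq M L)))/= [X in _ + X]big_seq_cond [X in _ + X]big1 ?addr0.
  rewrite -big_filter; apply: sum_subseq; [by move=> p; exact: coef_sqr_ge0|exact: filter_uniq|exact: box_seq_uniq|].
  by move=> p; rewrite mem_filter => /andP[].
move=> p /andP[ps pout]; apply: (coef_sqr_eq0 uL vL); apply: contra pout => /mapP[[l r] _ pE].
have pM : (`|p.1| <= M)%N by exact: (leq_bigmax_seq (F := fun p => `|p.1|%N)).
have hi : (`|(p.1 + M%:Z)%R| < (2 * M).+1)%N by lia.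
apply/mapP; exists (Ordinal hi, (l, r)); first by rewrite mem_enum.
by case: p pE pM hi {ps} => p1 p2 /= pE pM hi; rewrite /box_index/= -pE; congr (_, _); lia.
Qed.

Lemma win_lip x y : `|win x - win y| <= `|x - y|.
Proof.
have h z : (win z = 1 - `|z| /\ `|z| <= 1) \/ (win z = 0 /\ 1 <= `|z|).
  by rewrite /tent; case: (lerP 0 (1 - `|z|)) => hz; [left|right]; split=> //; lra.
have h1 := ler_dist_dist x y; move: h1; rewrite !ler_norml => /andP[h1 h2].
by case: (h x) => [] [-> ?]; case: (h y) => [] [-> ?]; apply/andP; split; lra.
Qed.

Section CommonZero.
Variable th : R.
Hypothesis Z : forall r, (r < q)%N ->
  zakc b J th (1 / (2 * q%:R) - r%:R / q%:R) = 0 /\ zaks b J th (1 / (2 * q%:R) - r%:R / q%:R) = 0.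

Let x0 : R := T / (2 * q%:R).
Variables (L : nat) (de : R).
Hypotheses (JL : (J <= L)%N) (de0 : 0 < de) (deT : de <= T / 4).
Let E : set R := `[x0, x0 + de].

Let x0T : 0 < x0 /\ x0 + de < T.
Proof.
have T0' := T0; have q1 : 1 <= q%:R :> R by rewrite ler1n.
have deT' := deT.
split; first by rewrite /x0 divr_gt0// mulr_gt0.
have : x0 <= T / 2.
  by rewrite /x0 ler_pM2l// lef_pV2 ?posrE ?mulr_gt0// ler_peMr.
lra.
Qed.

(** A bump of height c (i th) at the same place in each cell. For c = cos and
   c = sin these are the real and imaginary parts of a train of bumps with
   phases e^(i n th). *)
Definition train (c : R -> R) (x : R) : R :=
  \sum_(i < 2 * L) c (i%:R * th) * \1_E (x - cell_shift T L i).

Variable c : R -> R.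
Hypothesis cle1 : forall x, `|c x| <= 1.
Hypothesis ctrig : exists al be : R, forall x, c x = al * cos x + be * sin x.

Lemma train_val x i : I x -> (i < 2 * L)%N -> train c (x + cell_shift T L i) = c (i%:R * th) * \1_E x.
Proof.
move=> Ix i2; have /andP[x1 x2] : 0 <= x <= T by move: Ix; rewrite /I/= in_itv.
have [xp xT] := x0T; have T0' := T0.
rewrite /train (bigD1 (Ordinal i2))//= addrK big1 ?addr0// => j ji.
rewrite indicE memNset ?mulr0//= /E/= in_itv/= => /andP[h1 h2].
have ij : (j != i :> nat) by apply: contra ji => /eqP e; apply/eqP/val_inj.
move: h1 h2; rewrite /cell_shift; case: (ltngtP j i) ij => // hij _ h1 h2.
  have h : j%:R + 1 <= i%:R :> R by rewrite natr1 ler_nat.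
  have : 1 * T <= (i%:R - j%:R) * T by rewrite ler_pM2r//; lra.
  lra.
have h : i%:R + 1 <= j%:R :> R by rewrite natr1 ler_nat.
have : 1 * T <= (j%:R - i%:R) * T by rewrite ler_pM2r//; lra.
lra.
Qed.

Lemma supported_train : supported T L (train c).
Proof.
have [xp xT] := x0T; have T0' := T0.
move=> x xL; rewrite /train big1// => i _; rewrite indicE memNset ?mulr0//= /E/= in_itv/= => /andP[h1 h2].
have i1 : i%:R + 1 <= 2 * L%:R :> R by rewrite natr1 -natrM ler_nat.
have i0 : 0 <= i%:R :> R by [].
have j1 : (i%:R + 1) * T <= 2 * L%:R * T by rewrite ler_pM2r.
have j0 : 0 <= i%:R * T by rewrite mulr_ge0// ltW.
move: xL; rewrite ltNge => /negP; apply; rewrite ler_norml; move: h1 h2; rewrite /cell_shift.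
by move=> h1 h2; apply/andP; split; lra.
Qed.

Let mE : @measurable _ (measurableTypeR R) E. Proof. exact: measurable_itv. Qed.

Let muE : mu E = de%:E.
Proof.
rewrite /E lebesgue_measure_itv/= lte_fin ltrDl de0 -EFinB; congr EFin; ring.
Qed.

Lemma sqint_indic (c0 : R) : sqint setT (fun x => \1_E (x - c0)).
Proof.
have EE : (fun x => \1_E (x - c0)) = \1_(`[x0 + c0, x0 + c0 + de]) :> (R -> R).
  apply/funext => x; rewrite !indicE; congr (nat_of_bool _)%:R.
  by apply/idP/idP; rewrite !inE /E/= !in_itv/=; lra.
rewrite EE; pose D : set R := `[x0 + c0, x0 + c0 + de]%classic.
have mD : @measurable _ (measurableTypeR R) D by exact: measurable_itv.
split; first exact: measurable_indic.
have Dfin : (mu D < +oo)%E.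
  by rewrite /D lebesgue_measure_itv/=; case: ifP => _; rewrite ltry.
have [_ iD] : sqint D (fun=> 1).
  by apply: (@sqint_bounded _ _ mD _ 1) => // x _; rewrite normr1.
have := (@integrable_mkcond _ (measurableTypeR R) R mu D (fun x => (1 ^+ 2)%:E) mD).1 iD.
congr (integrable _ _ _); apply/funext => x /=; rewrite patchE indicE; case: ifPn => //= _.
by rewrite expr0n.
Qed.

Lemma sqint_train : sqint setT (train c).
Proof.
apply: (sqint_sum measurableT) => i; apply: (sqintZ measurableT); exact: sqint_indic.
Qed.

Let P : R := (2 * J).+1%:R ^+ 2.

Lemma window_poly_zero r : (r < q)%N -> pcos (window_poly r x0) th = 0 /\ psin (window_poly r x0) th = 0.
Proof.
move=> rq; have := window_poly_zak x0 th r.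
have -> : b * x0 = 1 / (2 * q%:R).
  by rewrite /x0 /T mulrA mulfV ?gt_eqF.
have [-> ->] := Z rq; rewrite expr0n/= addr0 mulr0 /pabs2 => /eqP.
by rewrite paddr_eq0 ?sqr_ge0// !sqrf_eq0 => /andP[/eqP -> /eqP ->].
Qed.

(** In the i-th cell the train is c (i th) times one and the same indicator,
   which therefore factors out of the convolution. *)
Lemma conv_coef x r l : I x -> (sample_poly L (train c) x * window_poly r x)`_l =
  \1_E x * \sum_(j < (2 * J).+1) (if (j <= l)%N && (l - j < 2 * L)%N then (window_poly r x)`_j * c ((l - j)%:R * th) else 0).
Proof.
move=> Ix; rewrite mulrC coefM mulr_sumr.
pose F j := (window_poly r x)`_j * (sample_poly L (train c) x)`_(l - j).
have FE j : (j <= l)%N -> F j = \1_E x * (if (l - j < 2 * L)%N then (window_poly r x)`_j * c ((l - j)%:R * th) else 0).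
  move=> jl; rewrite /F [(sample_poly _ _ _)`_ _]coef_poly; case: (boolP (l - j < 2 * L)%N) => h; last by rewrite !mulr0.
  by rewrite train_val//; ring.
have G0 j : ((2 * J).+1 <= j)%N -> (window_poly r x)`_j = 0.
  by move=> h; rewrite coef_poly ltnNge h.
pose n := maxn l.+1 (2 * J).+1.
pose H j := \1_E x * (if (j <= l)%N && (l - j < 2 * L)%N then (window_poly r x)`_j * c ((l - j)%:R * th) else 0).
transitivity (\sum_(0 <= j < n) H j).
  rewrite -(big_mkord xpredT F) [RHS](big_cat_nat (n := l.+1))//=; last exact: leq_maxl.
  rewrite [X in _ = _ + X]big_nat_cond [X in _ = _ + X]big1 ?addr0.
    by rewrite !big_nat; apply: eq_bigr => j /andP[_ jl]; have jl' : (j <= l)%N := jl; rewrite FE// /H jl'.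
  by move=> j /andP[/andP[h _] _]; rewrite /H leqNgt h/= mulr0.
rewrite -(big_mkord xpredT H) (big_cat_nat (n := (2 * J).+1))//=; last exact: leq_maxr.
rewrite [X in _ + X]big_nat_cond [X in _ + X]big1 ?addr0//.
by move=> j /andP[/andP[h _] _]; rewrite /H G0// mul0r if_same mulr0.
Qed.

Lemma window_poly_coef_bound r x j : `|(window_poly r x)`_j| <= 1.
Proof. by rewrite coef_poly; case: ifP => _; rewrite ?normr0// win_norm. Qed.

(** The crude bound, used where the convolution involves cells outside the
   train. *)
Lemma conv_edge x r l : I x -> (sample_poly L (train c) x * window_poly r x)`_l ^+ 2 <= P * \1_E x.
Proof.
move=> Ix; rewrite conv_coef// exprMn.
have -> : (\1_E x) ^+ 2 = \1_E x :> R by rewrite indicE; case: (_ \in _); rewrite ?expr1n// expr0n.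
rewrite [leLHS]mulrC; apply: ler_wpM2r; first by rewrite indicE; case: (_ \in _).
rewrite -real_normK ?num_real// /P ler_sqr ?nnegrE//.
apply: le_trans (ler_norm_sum _ _ _) _.
apply: le_trans (_ : \sum_(j < (2 * J).+1) (1 : R) <= _); last by rewrite sumr_const card_ord.
apply: ler_sum => j _; case: ifP => _; last by rewrite normr0.
by rewrite normrM mulr_ile1// window_poly_coef_bound.
Qed.

(** Here the convolution meets no end of the train, so that at x0 it is, up
   to a rotation by l th, the value of the window polynomial at e^(i th),
   which is 0. The window is 1-Lipschitz, hence each of the 2 J + 1 terms
   differs by at most de from its value at x0. *)
Lemma conv_mid x r l : I x -> (r < q)%N -> (2 * J <= l)%N -> (l < 2 * L)%N ->
  (sample_poly L (train c) x * window_poly r x)`_l ^+ 2 <= P * de ^+ 2 * \1_E x.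
Proof.
move=> Ix rq l1 l2; rewrite conv_coef// exprMn.
have -> : (\1_E x) ^+ 2 = \1_E x :> R by rewrite indicE; case: (_ \in _); rewrite ?expr1n// expr0n.
rewrite indicE; case: (boolP (x \in E)) => xE; last by rewrite mul0r mulr0.
rewrite mul1r mulr1.
have {}xE : x0 <= x <= x0 + de by move: xE; rewrite inE /E/= in_itv.
have cond (j : 'I_(2 * J).+1) : (j <= l)%N && (l - j < 2 * L)%N by have := ltn_ord j; clear -l1 l2; lia.
have [pc ps] := window_poly_zero rq.
have sz : (size (window_poly r x0) <= (2 * J).+1)%N by exact: size_poly.
have z0 : \sum_(j < (2 * J).+1) (window_poly r x0)`_j * c ((l - j)%:R * th) = 0.
  have [al [be cE]] := ctrig.
  transitivity ((al * cos (l%:R * th) + be * sin (l%:R * th)) * pcos (window_poly r x0) th +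
     (al * sin (l%:R * th) - be * cos (l%:R * th)) * psin (window_poly r x0) th); last first.
    by rewrite pc ps !mulr0 addr0.
  rewrite (pcosE _ sz) (psinE _ sz) !mulr_sumr -big_split/=; apply: eq_bigr => j _.
  have jl : (j <= l)%N by case/andP: (cond j).
  rewrite natrB// mulrBl cE cosB sinB; generalize ((window_poly r x0)`_j) => g; ring.
rewrite (eq_bigr (fun j : 'I_(2 * J).+1 => (window_poly r x)`_j * c ((l - j)%:R * th))); last first.
  by move=> j _; rewrite cond.
rewrite -[X in X ^+ 2]subr0 -[X in _ - X]z0 -sumrB.
rewrite -real_normK ?num_real// /P -exprMn ler_sqr ?nnegrE ?mulr_ge0// ?(ltW de0)//.
apply: le_trans (ler_norm_sum _ _ _) _.
apply: le_trans (_ : \sum_(j < (2 * J).+1) de <= _); last first.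
  by rewrite sumr_const card_ord mulr_natl.
apply: ler_sum => j _; rewrite -mulrBl normrM -[leRHS]mulr1 ler_pM//.
rewrite !coef_poly ltn_ord; apply: le_trans (win_lip _ _) _.
set e := (J%:R - j%:R) * T; have -> : x - a * r%:R + e - (x0 - a * r%:R + e) = x - x0 by ring.
by rewrite ger0_norm; lra.
Qed.

(** The 2 L - 2 J interior coefficients obey conv_mid, and the 4 J others
   conv_edge. *)
Lemma fiber_energy_train x : I x ->
  fiber_energy L (train c) x <= q%:R * (P * (2 * L%:R * de ^+ 2 + 4 * J%:R)) * \1_E x.
Proof.
move=> Ix; rewrite /fiber_energy.
have i0 : 0 <= (\1_E x : R) by rewrite indicE; case: (_ \in _).
apply: le_trans (_ : \sum_(r < q) (P * (2 * L%:R * de ^+ 2 + 4 * J%:R)) * \1_E x <= _); last first.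
  by rewrite sumr_const card_ord -[leLHS]mulr_natl mulrA.
apply: ler_sum => r _; have rq := ltn_ord r.
rewrite -(big_mkord xpredT (fun l => (sample_poly L (train c) x * window_poly r x)`_l ^+ 2)).
rewrite (big_cat_nat (n := 2 * J))//=; last by rewrite leq_mul2l leq_addl.
rewrite (big_cat_nat (n := 2 * L) (m := 2 * J))//=; [|by rewrite leq_mul2l|by rewrite leq_mul2l leq_addr].
have B1 : \sum_(0 <= l < 2 * J) (sample_poly L (train c) x * window_poly r x)`_l ^+ 2 <= 2 * J%:R * (P * \1_E x).
  apply: le_trans (_ : \sum_(0 <= l < 2 * J) P * \1_E x <= _).
    by apply: ler_sum => l _; exact: conv_edge.
  by rewrite sumr_const_nat subn0 -[leLHS]mulr_natl natrM.
have B3 : \sum_(2 * L <= l < 2 * (L + J)) (sample_poly L (train c) x * window_poly r x)`_l ^+ 2 <= 2 * J%:R * (P * \1_E x).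
  apply: le_trans (_ : \sum_(2 * L <= l < 2 * (L + J)) P * \1_E x <= _).
    by apply: ler_sum => l _; exact: conv_edge.
  by rewrite sumr_const_nat -mulnBr addKn -[leLHS]mulr_natl natrM.
have B2 : \sum_(2 * J <= l < 2 * L) (sample_poly L (train c) x * window_poly r x)`_l ^+ 2 <= 2 * L%:R * (P * de ^+ 2 * \1_E x).
  apply: le_trans (_ : \sum_(2 * J <= l < 2 * L) P * de ^+ 2 * \1_E x <= _).
    by apply: ler_sum_nat => l /andP[h1 h2]; exact: conv_mid.
  rewrite sumr_const_nat -[leLHS]mulr_natl; apply: ler_wpM2r.
    by rewrite mulr_ge0// mulr_ge0// sqr_ge0.
  by rewrite -natrM ler_nat leq_subr.
apply: le_trans (lerD B1 (lerD B2 B3)) _.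
rewrite le_eqVlt; apply/orP; left; apply/eqP; ring.
Qed.

Lemma Rint_E : mu.-integrable I (EFin \o (\1_E : R -> R)) /\ \int[mu]_(x in I) (\1_E x : R) = de.
Proof.
have [xp xT] := x0T.
have [_ iE] : sqint I (\1_E : R -> R).
  apply: (@sqint_bounded _ _ measurable_I _ 1); [exact: measure_I_fin|exact: measurable_indic|].
  by move=> x _; rewrite indicE; case: (_ \in _); rewrite /= ?normr1 ?normr0.
have e2 x : (\1_E x) ^+ 2 = \1_E x :> R by rewrite indicE; case: (_ \in _); rewrite ?expr1n// expr0n.
split; first by move: iE; apply: eq_integrable => // x _ /=; rewrite e2.
rewrite /Rintegral integral_indic//; transitivity (fine de%:E) => //; congr fine.
rewrite -[RHS]muE; congr (mu _); apply/seteqP; split => x /=; first by case.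
by move=> Ex; split=> //; move: Ex; rewrite /E/I/= !in_itv/=; lra.
Qed.

(** To be compared with the squared norm of the train, which is of order L
   de: the ratio is O(de^2) + O(J / L). *)
Lemma box_energy_train M : box_energy M L (train c) <=
  T * (q%:R * (P * (2 * L%:R * de ^+ 2 + 4 * J%:R)) * de).
Proof.
have [iE eE] := Rint_E; have [iF _] := Rint_fiber_energy L sqint_train.
apply: le_trans (box_energy_le_fiber M L sqint_train) _; rewrite ler_pM2l// -[X in _ <= _ * X]eE -RintegralZl//.
apply: le_Rintegral => //; first exact: integrableZ_EFin.
by move=> x Ix; exact: fiber_energy_train.
Qed.

Lemma ip_train : ip setT (train c) (train c) = \sum_(i < 2 * L) c (i%:R * th) ^+ 2 * de.
Proof.
have [iE eE] := Rint_E; have [_ ->] := ip_samples sqint_train supported_train.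
transitivity (\int[mu]_(x in I) ((\sum_(i < 2 * L) c (i%:R * th) ^+ 2) * \1_E x)).
  apply: eq_Rintegral => x /[!inE] Ix; rewrite mulr_suml; apply: eq_bigr => i _.
  by rewrite train_val// exprMn indicE; case: (_ \in _); rewrite ?expr1n// expr0n.
by rewrite RintegralZl// eE mulr_suml.
Qed.

End CommonZero.

End GaborReal.

(** * Complex-valued functions and the frame property *)

Section ComplexLevel.
Context {R : realType}.
Local Open Scope complex_scope.
Local Notation mu := (@lebesgue_measure R).
Local Notation normc := ComplexField.Normc.normc.
Implicit Types (f : R -> R[i]) (u v : R -> R).

Lemma normc_sqr (x y : R) : normc (x +i* y) ^+ 2 = x ^+ 2 + y ^+ 2.
Proof. by rewrite /= sqr_sqrtr// addr_ge0// sqr_ge0. Qed.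

Lemma measurable_sqr_sum u v : measurable_fun setT u -> measurable_fun setT v ->
  measurable_fun setT (fun x => u x ^+ 2 + v x ^+ 2).
Proof. by move=> mu mv; apply: measurable_funD; exact: measurable_funX. Qed.

Lemma L2fun_sqint f : L2fun f ->
  sqint setT (fun x => complex.Re (f x)) /\ sqint setT (fun x => complex.Im (f x)).
Proof.
pose u x := complex.Re (f x); pose v x := complex.Im (f x).
rewrite -/u -/v => -[mu' mv fin].
have e x : normc (f x) ^+ 2 = u x ^+ 2 + v x ^+ 2.
  by rewrite /u /v; case: (f x) => x1 y1; rewrite normc_sqr.
have iuv : mu.-integrable setT (fun x => (u x ^+ 2 + v x ^+ 2)%:E).
  apply/integrableP; split; first by apply/measurable_EFinP; exact: measurable_sqr_sum.
  apply: le_lt_trans fin; rewrite /sq_norm2; apply: ge0_le_integral => //.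
  - by apply/measurable_EFinP; apply: measurableT_comp => //; exact: measurable_sqr_sum.
  - apply/measurable_EFinP; rewrite (_ : (fun _ => _) = fun x => u x ^+ 2 + v x ^+ 2); first exact: measurable_sqr_sum.
    exact/funext.
  - by move=> x _; rewrite lee_fin e ger0_norm// addr_ge0// sqr_ge0.
split; split => //; apply: (le_integrable measurableT _ _ iuv).
- by apply/measurable_EFinP; exact: measurable_funX.
- by move=> x _; rewrite /= lee_fin !ger0_norm ?addr_ge0 ?sqr_ge0// lerDl sqr_ge0.
- by apply/measurable_EFinP; exact: measurable_funX.
- by move=> x _; rewrite /= lee_fin !ger0_norm ?addr_ge0 ?sqr_ge0// lerDr sqr_ge0.
Qed.

Lemma sq_norm2E f :
  sqint setT (fun x => complex.Re (f x)) -> sqint setT (fun x => complex.Im (f x)) ->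
  sq_norm2 f = (ip setT (fun x => complex.Re (f x)) (fun x => complex.Re (f x)) +
                ip setT (fun x => complex.Im (f x)) (fun x => complex.Im (f x)))%:E.
Proof.
set u := (fun x => complex.Re (f x)); set v := (fun x => complex.Im (f x)) => su sv.
have e x : normc (f x) ^+ 2 = u x ^+ 2 + v x ^+ 2.
  by rewrite /u /v; case: (f x) => x1 y1; rewrite normc_sqr.
have iu := sqint_mul measurableT su su; have iv := sqint_mul measurableT sv sv.
rewrite /sq_norm2 /ip -RintegralD//.
transitivity (\int[mu]_x (u x * u x + v x * v x)%:E)%E.
  by apply: eq_integral => x _; rewrite e !expr2.
by rewrite /Rintegral fineK//; apply: integrable_fin_num => //; have := integrableD measurableT iu iv.
Qed.

Lemma sqint_L2fun f :
  sqint setT (fun x => complex.Re (f x)) -> sqint setT (fun x => complex.Im (f x)) -> L2fun f.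
Proof.
move=> su sv; split; [exact: su.1|exact: sv.1|].
by rewrite sq_norm2E// ltry.
Qed.

(** This is the passage from the complex system to the real coefficients, the
   window being real. *)
Lemma normc_inner (a b : R) f p :
  sqint setT (fun x => complex.Re (f x)) -> sqint setT (fun x => complex.Im (f x)) ->
  normc (inner f (gabor_system (fun x : R => (Q2 x)%:C) a b p)) ^+ 2 =
  coef_sqr a b (fun x => complex.Re (f x)) (fun x => complex.Im (f x)) p.
Proof.
set u := (fun x => complex.Re (f x)); set v := (fun x => complex.Im (f x)) => su sv.
case: p => m k; have [sc ss] := sqint_atom a b k m.
have E x : f x * (gabor_system (fun x : R => (Q2 x)%:C) a b (m, k) x)^*%C =
   (u x * atom_cos a b k m x + v x * atom_sin a b k m x) +i*
   (v x * atom_cos a b k m x - u x * atom_sin a b k m x).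
  rewrite /gabor_system /expi /= Q2E /atom_cos /atom_sin /mode_cos /mode_sin /u /v /tent.
  have -> : 2 * pi * m%:~R * b * x = m%:~R * (2 * pi * b * x) by ring.
  case: (f x) => x1 y1.
  by apply/eqP; rewrite eq_complex/=; apply/andP; split; apply/eqP; ring.
have icu := sqint_mul measurableT su sc; have isu := sqint_mul measurableT su ss.
have icv := sqint_mul measurableT sv sc; have isv := sqint_mul measurableT sv ss.
rewrite /inner /cintegral normc_sqr /coef_sqr /coef_cos /coef_sin /ip /=.
rewrite -RintegralD// -RintegralB//.
by congr (_ ^+ 2 + _ ^+ 2); apply: eq_Rintegral => x _; rewrite E.
Qed.

(** The unconditional sum is the supremum of the finite ones: it suffices to
   bound all finite sums from above, and to exhibit for each function one
   finite sum that is large enough. *)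
Lemma is_frame_of_coef_bounds (a b A B : R) : 0 < A -> A <= B ->
  (forall u v, sqint setT u -> sqint setT v ->
     exists2 s : seq (int * int), uniq s &
       A * (ip setT u u + ip setT v v) <= \sum_(p <- s) coef_sqr a b u v p) ->
  (forall (s : seq (int * int)) u v, sqint setT u -> sqint setT v -> uniq s ->
     \sum_(p <- s) coef_sqr a b u v p <= B * (ip setT u u + ip setT v v)) ->
  is_frame (gabor_system (fun x : R => (Q2 x)%:C) a b).
Proof.
move=> A0 AB lowerA upperB; exists A, B; split => // f /L2fun_sqint[su sv].
rewrite sq_norm2E//.
under eq_esum do rewrite (normc_inner)//.
split.
  have [s us h] := lowerA _ _ su sv.
  apply: esum_ge; exists [set` s]; first by split=> //; exact: finite_seq.
  by rewrite -fsbig_seq// sumEFin lee_fin.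
apply: ge_ereal_sup => _ [X [finX _] <-].
by rewrite fsbig_finite// sumEFin lee_fin; apply: upperB => //; exact: finmap.fset_uniq.
Qed.

Lemma frame_lower_bound_le (a b A c : R) u v : sqint setT u -> sqint setT v ->
  (A%:E * sq_norm2 (fun x => u x +i* v x) <=
    \esum_(p in [set: int * int]) (normc (inner (fun x => u x +i* v x)
      (gabor_system (fun x : R => (Q2 x)%:C) a b p)) ^+ 2)%:E)%E ->
  (forall s : seq (int * int), uniq s -> \sum_(p <- s) coef_sqr a b u v p <= c) ->
  A * (ip setT u u + ip setT v v) <= c.
Proof.
move=> su sv; rewrite sq_norm2E//.
under eq_esum do rewrite (normc_inner)//.
move=> h hc; rewrite -lee_fin; apply: le_trans h _.
apply: ge_ereal_sup => _ [X [finX _] <-].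
by rewrite fsbig_finite// sumEFin lee_fin; apply: hc; exact: finmap.fset_uniq.
Qed.

End ComplexLevel.

(** * The criterion *)

Section Criterion.
Context {R : realType}.
Local Open Scope complex_scope.

Lemma round_near_spec (b : R) : 3 / 2 <= b -> exists N : nat,
  [/\ (2 <= N)%N, b = N%:R + frac_near b & `|frac_near b| <= 2^-1].
Proof.
move=> b32; have /andP[h1 h2] := floor_itv (b + 2^-1).
have n2 : (2 <= round_near b)%R.
  by rewrite /round_near floor_ge_int; lra.
exists `|round_near b|%N.
have e : `|round_near b|%N%:R = (round_near b)%:~R :> R.
  by rewrite pmulrn gez0_abs//; apply: le_trans n2.
rewrite e; split; [clear -n2; lia|by rewrite /frac_near; ring|].
by move: h1 h2; rewrite -/(round_near b) intrD ler_norml /frac_near => h1 h2; apply/andP; split; lra.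
Qed.

Lemma zaksum_ge0 (b : R) J q yt : 0 <= zaksum b J q yt.
Proof. by apply: sumr_ge0 => r _; rewrite addr_ge0// sqr_ge0. Qed.

Lemma zaksum_eq0 (b : R) J q y t : zaksum b J q (y, t) = 0 -> forall r, (r < q)%N ->
  zakc b J t (y - r%:R / q%:R) = 0 /\ zaks b J t (y - r%:R / q%:R) = 0.
Proof.
move=> z0 r rq.
have /(_ (Ordinal rq) isT)/eqP := psumr_eq0P (fun i _ => addr_ge0 (sqr_ge0 _) (sqr_ge0 _)) z0.
by rewrite paddr_eq0 ?sqr_ge0// !sqrf_eq0 => /andP[/eqP -> /eqP ->].
Qed.

(** By compactness zaksum has a positive minimum. *)
Lemma frame_of_no_zero (q : nat) (a b : R) (J : nat) : (0 < q)%N -> 1 <= b ->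
  a * b = 1 / q%:R -> b <= J%:R ->
  (forall y t : R, 0 <= y <= 1 -> zaksum b J q (y, t) != 0) ->
  is_frame (gabor_system (fun x : R => (Q2 x)%:C) a b).
Proof.
move=> q0 b1 ab bJ nz; have [m0 [M0 [mM [y [t [y01 t2 m0E]]] bnd]]] := zaksum_bounds b J q.
have m0_gt0 : 0 < m0 by rewrite m0E lt_def zaksum_ge0 nz.
have b0 : 0 < b^-1 by rewrite invr_gt0; apply: lt_le_trans b1.
apply: (@is_frame_of_coef_bounds _ a b (b^-1 * (b ^- 2 * m0) / 4) (b^-1 * (b ^- 2 * M0))).
- by rewrite divr_gt0// A0_gt0.
- have := A0_gt0 b1 m0_gt0.
  have : b^-1 * (b ^- 2 * m0) <= b^-1 * (b ^- 2 * M0).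
    by rewrite ler_pM2l// ler_pM2l// invr_gt0 exprn_gt0// -invr_gt0.
  lra.
- by move=> u v su sv; apply: (coef_sqr_lower q0 b1 ab bJ bnd).
- by move=> s u v su sv us; apply: (coef_sqr_upper q0 b1 ab bJ bnd).
Qed.

(** The two trains have total squared norm 2 L de, so a lower frame bound A
   would give A L <= C (2 L de^2 + 4 J) with C independent of L and de. If
   de is small enough the term in de^2 is at most A L / 2, and then a large
   L is impossible. *)
Lemma no_frame_of_zero (q : nat) (a b : R) (J : nat) (th : R) : (0 < q)%N -> 1 <= b ->
  a * b = 1 / q%:R -> b <= J%:R ->
  (forall r, (r < q)%N -> zakc b J th (1 / (2 * q%:R) - r%:R / q%:R) = 0 /\
      zaks b J th (1 / (2 * q%:R) - r%:R / q%:R) = 0) ->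
  ~ is_frame (gabor_system (fun x : R => (Q2 x)%:C) a b).
Proof.
move=> q0 b1 ab bJ Z [A [B [A0 _ H]]].
have q0' : 0 < q%:R :> R by rewrite ltr0n.
pose T := b^-1; pose P : R := (2 * J).+1%:R ^+ 2.
have T0 : 0 < T by rewrite invr_gt0; apply: lt_le_trans b1.
have P0 : 0 < P by rewrite exprn_gt0.
have key (L : nat) (de : R) : (J <= L)%N -> 0 < de -> de <= T / 4 ->
    A * L%:R <= T * q%:R * P * (2 * L%:R * de ^+ 2 + 4 * J%:R).
  move=> JL de0 deT.
  pose u := train q b th L de cos; pose v := train q b th L de sin.
  have su : sqint setT u by exact: sqint_train.
  have sv : sqint setT v by exact: sqint_train.
  have := frame_lower_bound_le su sv (H _ (sqint_L2fun (f := fun x => u x +i* v x) su sv)).1.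
  move=> /(_ (2 * (T * (q%:R * (P * (2 * L%:R * de ^+ 2 + 4 * J%:R)) * de)))) h.
  have {}h := h _.
  have : A * (ip setT u u + ip setT v v) <= 2 * (T * (q%:R * (P * (2 * L%:R * de ^+ 2 + 4 * J%:R)) * de)).
    apply: h => s us.
    have [M hM] := coef_sqr_sum_le_box_energy q0 b1 ab bJ su sv (supported_train q0 b1 th deT cos)
      (supported_train q0 b1 th deT sin) us.
    apply: le_trans hM _; rewrite [leRHS]mulr_natl mulr2n.
    apply: lerD; apply: (box_energy_train q0 b1 ab bJ Z JL de0 deT) => //.
    + by move=> x; exact: cos_max.
    + by exists 1, 0 => x; ring.
    + by move=> x; exact: sin_max.
    + by exists 0, 1 => x; ring.
  rewrite /u /v !(ip_train q0 b1 th _ de0 deT) -big_split/=.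
  under eq_bigr do rewrite -mulrDl cos2Dsin2 mul1r.
  rewrite sumr_const card_ord -[X in A * X]mulr_natl natrM => h1.
  have d2 : 0 < 2 * de by rewrite mulr_gt0.
  rewrite -(ler_pM2r d2); apply: le_trans (le_trans h1 _).
    by rewrite le_eqVlt; apply/orP; left; apply/eqP; ring.
  by rewrite le_eqVlt; apply/orP; left; apply/eqP; ring.
pose C := T * q%:R * P; have C0 : 0 < C by rewrite !mulr_gt0.
(* de <= 1 and de <= A / (4 C) give C de^2 <= A / 4. *)
pose de := Num.min (T / 4) (Num.min (A / (4 * C)) 1).
have de0 : 0 < de by rewrite /de !lt_min ltr01 !divr_gt0// mulr_gt0.
have de1 : de <= 1 by rewrite /de !ge_min lexx !orbT.
have deT : de <= T / 4 by rewrite /de ge_min lexx.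
have deA : C * de ^+ 2 <= A / 4.
  have dA : de <= A / (4 * C) by rewrite /de !ge_min lexx !orbT.
  apply: le_trans (_ : C * de <= _).
    by rewrite ler_pM2l// expr2 -[leRHS]mul1r ler_pM2r.
  by move: dA; rewrite ler_pdivlMr ?mulr_gt0// => dA; lra.
(* Past 8 C J / A, half of A L exceeds the contribution 4 C J of the ends. *)
pose L := (J + (Num.truncn (8 * C * J%:R / A)).+1)%N.
have LA : 8 * C * J%:R / A < L%:R.
  rewrite /L natrD; apply: lt_le_trans (truncnS_gt _) _; by rewrite lerDr.
have := key L de (leq_addr _ _) de0 deT; rewrite -/C.
move: LA; rewrite ltr_pdivrMr// => LA.
have : C * de ^+ 2 * L%:R <= A / 4 * L%:R by apply: ler_wpM2r.
have J0 : 0 <= J%:R :> R by [].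
have := C0; have := A0.
move=> *; lra.
Qed.

End Criterion.

Local Open Scope complex_scope.

Theorem theorem3 (R : realType) (q : nat) (a b : R)
    (q_gt0 : (0 < q)%N) (a_gt0 : 0 < a) (b_ge : 3 / 2 <= b)
    (ab_eq : a * b = 1 / q%:R) :
  is_frame (gabor_system (fun x : R => (Q2 x)%:C) a b) <->
  1 / (2 * q%:R) < `|frac_near b|.
Proof.
have [N [N2 bE F12]] := round_near_spec b_ge.
have b1 : 1 <= b by lra.
have bJ : b <= N.+1%:R.
  by rewrite bE -natr1; have := ler_norm (frac_near b); lra.
split=> [fr|Fq].
  rewrite ltNge; apply/negP => Fq; move: fr; apply: (no_frame_of_zero q_gt0 b1 ab_eq bJ).
  by move=> r rq; exact: (zak_grid_zero N2 bE F12 (ltnSn N) bJ q_gt0 Fq rq).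
apply: (frame_of_no_zero q_gt0 b1 ab_eq bJ) => y t y01; apply/eqP => z0.
exact: (zak_no_grid_zero N2 bE F12 (ltnSn N) bJ q_gt0 Fq y01 (zaksum_eq0 z0)).
Qed.
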